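(* Let $g:[0,1]\to[0,\infty)$ be an integrable function with $g\not\equiv 0$ (i.e. $g$ is not almost everywhere zero) satisfying $$\int_0^1\frac{g(s)}{s}\,ds<\infty .$$ Then for every integer $N\ge 1$ and every collection (repetitions allowed) of points $a_0,\dots,a_{N-1}$ on the unit circle $\mathbb{T}$, $$\left\|\sum_{0\le k<N}\frac{1}{z-a_k}\right\|_{(g)}\ \ge\ \left\|\sum_{0\le k<N}\frac{1}{z-e^{2\pi i k/N}}\right\|_{(g)} .$$ In particular, for the power weights $g_\alpha(t)=t^\alpha$, the equally spaced configuration uniquely minimizes the norm $\|\cdot\|_{(g_\alpha)}$ (the $A^2_\alpha$ norm) for every $\alpha>0$: for every $\alpha>0$ the inequality above holds with $g=g_\alpha$, and if equality holds for $a_0,\dots,a_{N-1}\in\mathbb{T}$, then there is $c\in\mathbb{T}$ such that $a_0,\dots,a_{N-1}$ are, up to reordering, the points $c\,e^{2\pi i k/N}$, $0\le k<N$.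
   Context: $\mathbb{D}$ is the open unit disk in $\mathbb{C}$, $\mathbb{T}$ is the unit circle, and $dA$ is area measure on $\mathbb{D}$ (a constant normalization factor is immaterial). For a holomorphic function $f$ on $\mathbb{D}$, $$\|f\|_{(g)}^2=K_g\iint_{\mathbb{D}}|f(z)|^2\,g(1-|z|^2)\,dA(z),\qquad K_g=\left(\int_0^1 g(t)\,dt\right)^{-1}.$$ For $g_\alpha(t)=t^\alpha$ one has $K_{g_\alpha}=\alpha+1$, and the corresponding norm is the $A^2_\alpha(\mathbb{D})$ norm. *)

(* Defs.v *)
From HB Require Import structures.
From mathcomp Require Import all_boot all_order all_algebra.
From mathcomp Require Import complex.
From mathcomp Require Import all_classical all_reals all_analysis.

Set Implicit Arguments.
Unset Strict Implicit.
Unset Printing Implicit Defensive.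

Import Order.TTheory GRing.Theory Num.Theory.
Import numFieldNormedType.Exports.
Import Normc.

Local Open Scope classical_set_scope.
Local Open Scope ring_scope.
Local Open Scope complex_scope.

Definition cplx (R : realType) (p : R * R) : R[i] := p.1 +i* p.2.

(* [lebesgue_measure] and its product live on the Borel sigma-algebras.
   Weights are only assumed Lebesgue measurable, so area is the Caratheodory
   completion of the product, just as [completed_lebesgue_measure] is the
   completion of [lebesgue_measure]. It is unnormalized: the disk has area pi. *)
Definition area (R : realType) :=
  @completed_measure_extension _ _ R
    (@lebesgue_measure R \x @lebesgue_measure R)%E.

HB.instance Definition _ (R : realType) := Measure.on (@area R).

Definition unit_disk (R : realType) : set (R * R) :=
  [set p | normc (cplx p) < 1].

(* A weight on [0, 1] is a total function R -> R whose values outside [0, 1]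
   are never used. *)
Definition weight_const (R : realType) (g : R -> R) : R :=
  (Rintegral (@completed_lebesgue_measure R) `[0, 1] g)^-1.

(* The norm takes values in the extended reals: it is +oo when the integral
   diverges. *)
Definition weighted_norm (R : realType) (g : R -> R) (f : R[i] -> R[i])
    : \bar R :=
  (((weight_const g)%:E *
    \int[@area R]_(p in @unit_disk R)
      (normc (f (cplx p)) ^+ 2 * g (1 - normc (cplx p) ^+ 2))%:E)
     `^ 2^-1)%E.

Definition power_weight (R : realType) (alpha t : R) : R := t `^ alpha.

Definition cis (R : realType) (t : R) : R[i] := cos t +i* sin t.

Definition equispaced (R : realType) (N : nat) (k : 'I_N) : R[i] :=
  cis (2 * pi * k%:R / N%:R).

Definition cauchy_sum (R : realType) (N : nat) (a : 'I_N -> R[i]) (z : R[i])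
    : R[i] :=
  \sum_(k < N) (z - a k)^-1.

(* Main.v *)
Require Import Defs.
From mathcomp Require Import all_boot all_order all_algebra perm.
From mathcomp Require Import complex.
From mathcomp Require Import all_classical all_reals all_analysis.
From mathcomp Require Import measurable_realfun.
From mathcomp Require Import ring lra.

Set Implicit Arguments.
Unset Strict Implicit.
Unset Printing Implicit Defensive.

Import Order.TTheory GRing.Theory Num.Theory.
Import numFieldNormedType.Exports.
Import Normc.

(* On the circle |z|^2 = x the mean of |sum_k 1/(z - a_k)|^2 is
   m(x) = sum_jk w_jk / (1 - x w_jk) with w_jk = conj(a_j) a_k, so that
   2 x m(x) = (1 - x^2) sum_jk 1/|1 - x w_jk|^2 - N^2. For |w| = 1 there are
   positive constants with
     1/|1 - x w|^2 = c |sum_(i<N) w^i|^2 / |1 - x w|^2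
                     + sum_(d<N) c_d |sum_(n<d) (x w)^n|^2.
   Summed over all pairs, the last terms are positive combinations of squared
   moduli of power sums, and the first one is bounded below by its diagonal
   part j = k. Both bounds are attained by the N-th roots of unity, and equality
   forces all w_jk with j <> k to be nontrivial N-th roots of unity.

   To pass from circles to the disk without integrating in polar coordinates:
   the difference |f|^2 - m is a combination, with radial coefficients, of terms
   u/(1 - u) with u = z conj(a_k) and of their conjugates; the average of such a
   term over the rotations by M-th roots of unity is u^M/(1 - u^M), which
   tends to 0 uniformly on smaller disks. As area is invariant under rotations
   (products of three shears), the difference integrates to 0 against bounded
   radial weights, and monotone convergence gives the general case. *)

Local Open Scope classical_set_scope.
Local Open Scope ring_scope.

(** * Energy of points on the unit circle *)

Section Algebra.
Variable C : numClosedFieldType.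
Implicit Types (w x z : C).

Lemma conjC_unit w : `|w| = 1 -> w^* = w^-1.
Proof.
by move=> w1; rewrite invC_norm w1 expr1n invr1 mul1r.
Qed.

Lemma norm_prim_root (c : C) (M : nat) : M.-primitive_root c -> `|c| = 1.
Proof.
move=> cP; have M0 := prim_order_gt0 cP.
have /eqP : `|c| ^+ M = 1 by rewrite -normrX (prim_expr_order cP) normr1.
by rewrite pexpr_eq1 // => /eqP.
Qed.

Definition ndist (i l : nat) : nat := ((i - l) + (l - i))%N.

Lemma unit_pow_ndist w (i l : nat) : `|w| = 1 ->
  w ^+ ndist i l + w^-1 ^+ ndist i l = w ^+ i * w^-1 ^+ l + w^-1 ^+ i * w ^+ l.
Proof.
move=> w1; have w0 : w != 0 by rewrite -normr_gt0 w1.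
have key m n : w ^+ (m + n) * w^-1 ^+ m = w ^+ n.
  by rewrite exprD mulrAC -exprMn divff // expr1n mul1r.
have key2 m n : w^-1 ^+ (m + n) * w ^+ m = w^-1 ^+ n.
  by rewrite exprD mulrAC -exprMn mulVf // expr1n mul1r.
rewrite /ndist; case: (leqP i l) => [il|/ltnW li].
  rewrite (eqP il) add0n -{3 4}(subnKC il).
  by rewrite [_ * w^-1 ^+ _]mulrC [w^-1 ^+ i * _]mulrC key key2 addrC.
by rewrite (eqP li) addn0 -{3 4}(subnKC li) key key2.
Qed.

(** Doubling symmetrizes the expansion in [w] and [w^-1]: every pair (i, l) then contributes w^d +
    w^-d with d = |i - l|, which is the shape found in [sqr_norm_1subX]. *)
Lemma sqr_norm_geo w (N : nat) : `|w| = 1 ->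
  (`|\sum_(i < N) w ^+ i| ^+ 2) *+ 2 =
  \sum_(i < N) \sum_(l < N) (w ^+ ndist i l + w^-1 ^+ ndist i l).
Proof.
move=> w1.
have -> : \sum_(i < N) \sum_(l < N) (w ^+ ndist i l + w^-1 ^+ ndist i l) =
  \sum_(i < N) \sum_(l < N) (w ^+ i * w^-1 ^+ l) +
  \sum_(i < N) \sum_(l < N) (w^-1 ^+ i * w ^+ l).
  rewrite -big_split; apply: eq_bigr => i _.
  by rewrite -big_split; apply: eq_bigr => l _; rewrite unit_pow_ndist.
rewrite normCK rmorph_sum.
under [X in _ * X]eq_bigr do rewrite rmorphXn /= conjC_unit //.
rewrite mulr2n; congr (_ + _); last rewrite mulrC.
  by rewrite mulr_suml; apply: eq_bigr => i _; rewrite mulr_sumr.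
by rewrite mulr_suml; apply: eq_bigr => i _; rewrite mulr_sumr.
Qed.

(** The factor x^-d normalizes the coefficient of w^d + w^-d to -1 for every d, so that these
    identities can be added over different d and matched with [sqr_norm_geo]. *)
Lemma sqr_norm_1subX w x (d : nat) : `|w| = 1 -> 0 < x ->
  (x ^- d) * `|1 - (x * w) ^+ d| ^+ 2 = x ^+ d + x ^- d - (w ^+ d + w^-1 ^+ d).
Proof.
move=> w1 x0; have xr : x \is Num.real by rewrite ger0_real ?ltW.
have w0 : w != 0 by rewrite -normr_gt0 w1.
have xd0 : x ^+ d != 0 by rewrite expf_neq0 // gt_eqF.
rewrite normCK rmorphB rmorph1 rmorphXn rmorphM /= (conjC_unit w1) (conj_Creal xr).
rewrite !exprMn exprVn.
have wd0 : w ^+ d != 0 by rewrite expf_neq0.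
by field; rewrite wd0.
Qed.

Lemma norm1sub_neq0 w x : `|w| = 1 -> 0 <= x < 1 -> 1 - x * w != 0.
Proof.
move=> w1 /andP[x0 x1]; rewrite subr_eq0; apply/eqP => e.
have : `|x * w| = 1 by rewrite -e normr1.
by rewrite normrM w1 mulr1 ger0_norm // => xe; rewrite xe ltxx in x1.
Qed.

(* By [sqr_norm_geo] and [sqr_norm_1subX], the total weight minus
   [2 |sum w^i|^2] is the sum of the [x^-d |1 - (x w)^d|^2], where
   [1 - x w] divides [1 - (x w)^d]. *)
Lemma kernel_identity w x (N : nat) : `|w| = 1 -> 0 < x < 1 ->
  (\sum_(i < N) \sum_(l < N) (x ^+ ndist i l + x ^- ndist i l))
    * `|1 - x * w| ^- 2 =
  (`|\sum_(i < N) w ^+ i| ^+ 2 * `|1 - x * w| ^- 2) *+ 2 +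
  \sum_(i < N) \sum_(l < N)
    x ^- ndist i l * `|\sum_(n < ndist i l) (x * w) ^+ n| ^+ 2.
Proof.
move=> w1 /andP[x0 x1].
have n0 : `|1 - x * w| ^+ 2 != 0.
  by rewrite expf_neq0 // normr_eq0 norm1sub_neq0 // x1 ltW.
rewrite -mulrnAl sqr_norm_geo //; apply/eqP; rewrite -subr_eq0 opprD addrA -mulrBl.
rewrite -sumrB; under eq_bigr => i _ do rewrite -sumrB.
rewrite subr_eq0 mulr_suml; apply/eqP.
apply: eq_bigr => i _; rewrite mulr_suml; apply: eq_bigr => l _.
rewrite -sqr_norm_1subX // -mulrA; congr (_ * _).
rewrite -opprB normrN subrX1 normrM -normrN opprB exprMn mulrAC divff // mul1r.
by [].
Qed.

Lemma geo_root_eq0 (y : C) (n : nat) : y ^+ n = 1 -> y != 1 -> \sum_(i < n) y ^+ i = 0.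
Proof.
move=> yn y1; apply/eqP; have /eqP := subrX1 y n.
by rewrite yn subrr eq_sym mulf_eq0 subr_eq0 (negPf y1).
Qed.

Variables (N : nat).
Implicit Types a : 'I_N -> C.

Definition ratio a j k : C := (a j)^* * a k.

Definition pair_energy a x : C :=
  \sum_(j < N) \sum_(k < N) `|1 - x * ratio a j k| ^- 2.

Definition power_form a x (d : nat) : C :=
  \sum_(j < N) \sum_(k < N) `|\sum_(n < d) (x * ratio a j k) ^+ n| ^+ 2.

Lemma norm_ratio a j k : (forall k, `|a k| = 1) -> `|ratio a j k| = 1.
Proof. by move=> a1; rewrite normrM norm_conjC !a1 mulr1. Qed.

Lemma ratio_diag a k : (forall k, `|a k| = 1) -> ratio a k k = 1.
Proof. by move=> a1; rewrite /ratio mulrC -normCK a1 expr1n. Qed.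

(** After expanding the square, the sum over (j, k) of each (n, m) term factors as S times conj S,
    where S is the power sum of the points of exponent n - m. Every term is thus nonnegative. *)
Lemma power_formE a x d : (forall k, `|a k| = 1) -> 0 < x ->
  power_form a x d = \sum_(n < d) \sum_(m < d)
     x ^+ n * x ^+ m * `|\sum_(k < N) a k ^+ n * ((a k)^* ^+ m)| ^+ 2.
Proof.
move=> a1 x0; have xr : x \is Num.real by rewrite ger0_real ?ltW.
rewrite /power_form.
have E j k : `|\sum_(n < d) (x * ratio a j k) ^+ n| ^+ 2 =
  \sum_(n < d) \sum_(m < d) x ^+ n * x ^+ m *
    ((a k ^+ n * (a k)^* ^+ m) * (a j ^+ n * (a j)^* ^+ m)^*).
  rewrite normCK rmorph_sum /= mulr_suml; apply: eq_bigr => n _.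
  rewrite mulr_sumr; apply: eq_bigr => m _.
  rewrite !rmorphXn rmorphM /= (conj_Creal xr) /ratio !exprMn !rmorphM /=.
  by rewrite !rmorphXn /= ?conjCK exprMn; ring.
under eq_bigr => j _ do under eq_bigr => k _ do rewrite E.
rewrite exchange_big /=.
under eq_bigr => j _ do rewrite exchange_big /=.
rewrite exchange_big /=; apply: eq_bigr => n _.
under eq_bigr => j _ do rewrite exchange_big /=.
rewrite exchange_big /=; apply: eq_bigr => m _.
under eq_bigr => j _ do rewrite -mulr_sumr.
rewrite -mulr_sumr; congr (_ * _).
rewrite normCK rmorph_sum /= mulr_suml; apply: eq_bigr => j _.
by rewrite mulr_sumr.
Qed.

(** The diagonal n = m of [power_formE], where the power sum of N unit points equals N. *)
Definition power_bound x (d : nat) : C := \sum_(n < d) x ^+ n * x ^+ n * N%:R ^+ 2.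

Lemma power_form_ge a x d : (forall k, `|a k| = 1) -> 0 < x ->
  power_bound x d <= power_form a x d.
Proof.
move=> a1 x0; rewrite power_formE //; apply: ler_sum => n _.
rewrite (bigD1 n) //= -[X in X <= _]addr0; apply: lerD.
  under [X in _ <= _ * `|X| ^+ 2]eq_bigr => k _.
    by rewrite -exprMn -normCK a1 !expr1n; over.
  by rewrite sumr_const card_ord normr_nat.
by apply: sumr_ge0 => m _; rewrite !mulr_ge0 ?exprn_ge0 // ltW.
Qed.

(** The first summand comes from the pairs j = k, whose ratio is 1 and whose geometric sum is N. *)
Definition energy_bound x : C :=
  (N%:R * (N%:R ^+ 2 * (1 - x) ^- 2)) *+ 2 +
  \sum_(i < N) \sum_(l < N) x ^- ndist i l * power_bound x (ndist i l).

(** The factor of |1 - x w|^-2 in [kernel_identity]; the constant c of the overview is 2 divided by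
    it. *)
Definition energy_weight x : C :=
  \sum_(i < N) \sum_(l < N) (x ^+ ndist i l + x ^- ndist i l).

Lemma energyE a x : (forall k, `|a k| = 1) -> 0 < x < 1 ->
  energy_weight x * pair_energy a x =
  (\sum_(j < N) \sum_(k < N) `|\sum_(i < N) ratio a j k ^+ i| ^+ 2
      * `|1 - x * ratio a j k| ^- 2) *+ 2 +
  \sum_(i < N) \sum_(l < N) x ^- ndist i l * power_form a x (ndist i l).
Proof.
move=> a1 x01; rewrite /pair_energy /energy_weight.
rewrite mulr_sumr; under eq_bigr => j _.
  rewrite mulr_sumr; under eq_bigr => k _.
    rewrite (kernel_identity N (norm_ratio j k a1) x01); over.
  rewrite big_split /= sumrMnl.
  over.
rewrite big_split /= sumrMnl; congr (_ + _).
under eq_bigr => j _ do rewrite exchange_big /=.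
rewrite exchange_big /=; apply: eq_bigr => i _.
under eq_bigr => j _ do rewrite exchange_big /=.
rewrite exchange_big /=; apply: eq_bigr => l _.
rewrite /power_form mulr_sumr; apply: eq_bigr => j _; rewrite mulr_sumr.
by [].
Qed.

Lemma energy_weight_gt0 x : (0 < N)%N -> 0 < x -> 0 < energy_weight x.
Proof.
move=> N0 x0; have p i l : 0 < x ^+ ndist i l + x ^- ndist i l.
  by rewrite addr_gt0 ?exprn_gt0 ?invr_gt0 ?exprn_gt0.
rewrite /energy_weight (bigD1 (Ordinal N0)) //= ltr_pwDl //.
  rewrite (bigD1 (Ordinal N0)) //= ltr_pwDl //.
  by apply: sumr_ge0 => l _; exact: ltW.
by apply: sumr_ge0 => i _; apply: sumr_ge0 => l _; exact: ltW.
Qed.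

Definition offdiag a x : C :=
  \sum_(j < N) \sum_(k < N | k != j) `|\sum_(i < N) ratio a j k ^+ i| ^+ 2
      * `|1 - x * ratio a j k| ^- 2.

(** An exact formula rather than a bound, so that the lower bound, its attainment and the equality
    case can all be read off: the two terms after [energy_bound] are nonnegative. *)
Lemma energy_split a x : (forall k, `|a k| = 1) -> 0 < x < 1 ->
  energy_weight x * pair_energy a x = energy_bound x + offdiag a x *+ 2 +
  \sum_(i < N) \sum_(l < N) x ^- ndist i l *
     (power_form a x (ndist i l) - power_bound x (ndist i l)).
Proof.
move=> a1 x01; rewrite energyE //.
have -> : \sum_(j < N) \sum_(k < N) `|\sum_(i < N) ratio a j k ^+ i| ^+ 2
      * `|1 - x * ratio a j k| ^- 2 = N%:R * (N%:R ^+ 2 * (1 - x) ^- 2) + offdiag a x.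
  rewrite /offdiag.
  have -> : N%:R * (N%:R ^+ 2 * (1 - x) ^- 2) =
    \sum_(j < N) N%:R ^+ 2 * (1 - x) ^- 2 by rewrite sumr_const card_ord mulr_natl.
  rewrite -big_split /=; apply: eq_bigr => j _.
  rewrite (bigD1 j) //=; congr (_ + _); rewrite ratio_diag // mulr1.
  under eq_bigr do rewrite expr1n.
  rewrite sumr_const card_ord normr_nat [`|1 - x|]ger0_norm //.
  by rewrite subr_ge0 ltW //; case/andP: x01.
have -> : \sum_(i < N) \sum_(l < N) x ^- ndist i l *
     (power_form a x (ndist i l) - power_bound x (ndist i l)) =
   \sum_(i < N) \sum_(l < N) x ^- ndist i l * power_form a x (ndist i l) -
   \sum_(i < N) \sum_(l < N) x ^- ndist i l * power_bound x (ndist i l).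
  rewrite -sumrB; apply: eq_bigr => i _; rewrite -sumrB; apply: eq_bigr => l _.
  by rewrite mulrBr.
by rewrite /energy_bound mulrnDl; ring.
Qed.

Lemma offdiag_ge0 a x : 0 <= offdiag a x.
Proof.
by apply: sumr_ge0 => j _; apply: sumr_ge0 => k _; rewrite mulr_ge0 ?invr_ge0 ?exprn_ge0.
Qed.

(** Only the power form remainder is dropped; [offdiag] stays, since its vanishing characterizes
    equality. *)
Lemma energy_ge a x : (forall k, `|a k| = 1) -> 0 < x < 1 ->
  energy_bound x + offdiag a x *+ 2 <= energy_weight x * pair_energy a x.
Proof.
move=> a1 x01; rewrite energy_split // lerDl.
have x0 : 0 < x by case/andP: x01.
apply: sumr_ge0 => i _; apply: sumr_ge0 => l _.
by rewrite mulr_ge0 ?invr_ge0 ?exprn_ge0 ?subr_ge0 ?power_form_ge // ltW.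
Qed.

(** * Splitting |f|^2 into its circular mean and a fluctuation *)

Definition fluct_term a j z : C := z * (a j)^* / (1 - z * (a j)^*).

Definition fluctuation a z : C :=
  \sum_(j < N) \sum_(k < N) ratio a j k / (1 - `|z| ^+ 2 * ratio a j k) *
     (fluct_term a j z + (fluct_term a k z)^*).

Definition mean_energy a x : C :=
  \sum_(j < N) \sum_(k < N) ratio a j k / (1 - x * ratio a j k).

Lemma norm_mean_energy a x : (forall k, `|a k| = 1) -> 0 <= x < 1 ->
  `|mean_energy a x| <= N%:R ^+ 2 / (1 - x).
Proof.
move=> a1 /andP[x0 x1]; have d0 : 0 < 1 - x by rewrite subr_gt0.
apply: le_trans (ler_norm_sum _ _ _) _.
have -> : N%:R ^+ 2 / (1 - x) = \sum_(j < N) \sum_(k < N) (1 - x)^-1.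
  under [RHS]eq_bigr do rewrite sumr_const card_ord.
  by rewrite sumr_const card_ord -mulrnA -[RHS]mulr_natl natrM expr2.
apply: ler_sum => j _; apply: le_trans (ler_norm_sum _ _ _) _; apply: ler_sum => k _.
rewrite normrM norm_ratio // mul1r normfV.
have h : 1 - x <= `|1 - x * ratio a j k|.
  apply: le_trans (lerB_dist _ _); rewrite normr1 (normrM x) norm_ratio // mulr1.
  by rewrite ger0_norm.
by rewrite lef_pV2 ?posrE // (lt_le_trans d0).
Qed.

(** Put u = z conj(a_j) and v = z conj(a_k). The (j, k) term of the square is w_jk / ((1 - u)(1 -
    conj v)), and u conj v = |z|^2 w_jk. The splitting is the identity 1/((1 - u)(1 - v')) = (1 +
    u/(1 - u) + v'/(1 - v')) / (1 - u v') with v' = conj v. *)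
Lemma sqr_norm_cauchy a z : (forall k, `|a k| = 1) -> `|z| < 1 ->
  `|\sum_(k < N) (z - a k)^-1| ^+ 2 = mean_energy a (`|z| ^+ 2) + fluctuation a z.
Proof.
move=> a1 z1; have x01 : 0 <= `|z| ^+ 2 < 1 by rewrite exprn_ge0 // expr_lt1.
have a0 k : a k != 0 by rewrite -normr_gt0 a1.
have d0 k : 1 - z * (a k)^* != 0.
  rewrite subr_eq0; apply/eqP => E.
  have : `|z * (a k)^*| = 1 by rewrite -E normr1.
  by rewrite normrM norm_conjC a1 mulr1 => E'; rewrite E' ltxx in z1.
have E k : (z - a k)^-1 = - ((a k)^* / (1 - z * (a k)^*)).
  move: (d0 k); rewrite (conjC_unit (a1 k)).
  have -> : 1 - z / a k = (a k - z) / a k by rewrite mulrBl divff.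
  rewrite mulf_eq0 negb_or => /andP[d _].
  have d' : z - a k != 0 by rewrite -opprB oppr_eq0.
  by field; rewrite a0 d d'.
under eq_bigr do rewrite E.
rewrite normCK rmorph_sum /= mulr_suml /mean_energy /fluctuation -big_split /=.
apply: eq_bigr => j _; rewrite mulr_sumr -big_split /=; apply: eq_bigr => k _.
have := d0 k; rewrite -conjC_eq0 => dk; move: (dk).
have := norm1sub_neq0 (norm_ratio j k a1) x01.
rewrite /fluct_term !rmorphN !fmorph_div /= !rmorphB !rmorph1 !(rmorphM _ z) /= !conjCK.
rewrite /ratio normCK => dr dk'; move: (d0 j) dk' dr => dj dk' dr.
by field; rewrite dj dk' dr.
Qed.

(** Since (c^i u)^M = u^M, the term at c^i z is the polynomial sum_(n<M) (c^i u)^(n+1) divided by 1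
    - u^M. Summing over i kills all powers except the M-th. *)
Lemma fluct_term_avg a (c : C) (M : nat) j z : M.-primitive_root c -> `|a j| = 1 ->
  `|z| < 1 ->
  \sum_(i < M) fluct_term a j (c ^+ i * z) =
  M%:R * ((z * (a j)^*) ^+ M / (1 - (z * (a j)^*) ^+ M)).
Proof.
move=> cP aj1 z1; set u := z * _; have M0 := prim_order_gt0 cP.
have u1 : `|u| < 1 by rewrite normrM norm_conjC aj1 mulr1.
have c1 := norm_prim_root cP.
have uM : 1 - u ^+ M != 0.
  rewrite subr_eq0; apply/eqP => E.
  have : `|u ^+ M| = 1 by rewrite -E normr1.
  by rewrite normrX => /eqP; rewrite pexpr_eq1 // lt_eqF.
have E (i : 'I_M) : fluct_term a j (c ^+ i * z) =
    (1 - u ^+ M)^-1 * \sum_(n < M) u ^+ n.+1 * (c ^+ n.+1) ^+ i.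
  have v1 : 1 - c ^+ i * u != 0.
    rewrite subr_eq0; apply/eqP => E.
    have : `|c ^+ i * u| = 1 by rewrite -E normr1.
    by rewrite normrM normrX c1 expr1n mul1r => e1; rewrite e1 ltxx in u1.
  rewrite /fluct_term -[c ^+ i * z * _]mulrA -/u.
  apply: (canRL (mulKf uM)); rewrite mulrA; apply: (canLR (mulfK v1)).
  have -> : \sum_(n < M) u ^+ n.+1 * (c ^+ n.+1) ^+ i =
     (c ^+ i * u) * \sum_(n < M) (c ^+ i * u) ^+ n.
    rewrite mulr_sumr; apply: eq_bigr => n _.
    by rewrite -exprS [in RHS](exprMn _ (c ^+ i)) -exprM mulnC exprM mulrC.
  have -> : 1 - u ^+ M = 1 - (c ^+ i * u) ^+ M.
    by rewrite [in RHS](exprMn _ (c ^+ i)) -exprM mulnC exprM (prim_expr_order cP) expr1n mul1r.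
  by rewrite -[1 - _ ^+ M]opprB subrX1; ring.
under eq_bigr do rewrite E.
rewrite -mulr_sumr mulrC [RHS]mulrA; congr (_ / _).
rewrite exchange_big /=; under eq_bigr => n _ do rewrite -mulr_sumr.
(* The exponents are n.+1, so the surviving index is M.-1; for the other n the inner sum is a full
   geometric sum of the nontrivial M-th root of unity c^(n+1). *)
have Mp : (M.-1 < M)%N by rewrite prednK.
rewrite (bigD1 (Ordinal Mp)) //= prednK // (prim_expr_order cP).
under eq_bigr do rewrite expr1n.
rewrite sumr_const card_ord [RHS]mulrC [X in _ + X]big1 ?addr0 // => n nM.
rewrite geo_root_eq0 ?mulr0 //.
  by rewrite -exprM mulnC exprM (prim_expr_order cP) expr1n.
rewrite -(prim_order_dvd cP); apply: contra nM => /dvdn_leq; rewrite -val_eqE /=.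
by move=> /(_ isT) Mn; rewrite -eqSS prednK // eqn_leq Mn ltn_ord.
Qed.

(** The rotations preserve |z|, so the radial coefficients leave the sum over i. The averaged terms
    have numerators at most rho^M; their denominators, and that of the coefficient, are at least 1 -
    rho. The factor 2 counts a term and a conjugate term, N^2 the pairs. *)
Lemma norm_fluct_avg a (c : C) (M : nat) z (rho : C) : M.-primitive_root c ->
  (forall k, `|a k| = 1) -> `|z| <= rho -> rho < 1 ->
  `|\sum_(i < M) fluctuation a (c ^+ i * z)| <=
  M%:R * (N%:R ^+ 2 * (rho ^+ M *+ 2 / (1 - rho) ^+ 2)).
Proof.
move=> cP a1 zr r1; have M0 := prim_order_gt0 cP.
have z1 : `|z| < 1 := le_lt_trans zr r1.
have r0 : 0 <= rho := le_trans (normr_ge0 _) zr.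
have r01 : 0 < 1 - rho by rewrite subr_gt0.
have c1 := norm_prim_root cP.
have key t : `|t| <= rho -> `|1 - t|^-1 <= (1 - rho)^-1.
  move=> tr; have h : 1 - rho <= `|1 - t|.
    by apply: le_trans (lerB_dist _ _); rewrite normr1 lerD2l lerN2.
  by rewrite lef_pV2 ?posrE // (lt_le_trans r01).
pose v k := (z * (a k)^*) ^+ M / (1 - (z * (a k)^*) ^+ M).
have vle k : `|v k| <= rho ^+ M / (1 - rho).
  have uM : `|(z * (a k)^*) ^+ M| <= rho ^+ M.
    by rewrite normrX normrM norm_conjC a1 mulr1 lerXn2r ?nnegrE.
  rewrite /v normrM normfV; apply: ler_pM; rewrite ?invr_ge0 //.
  apply: key; apply: le_trans uM _; rewrite -(prednK M0) exprS.
  by rewrite ler_piMr // exprn_ile1 // ltW.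
have -> : \sum_(i < M) fluctuation a (c ^+ i * z) =
  M%:R * \sum_(j < N) \sum_(k < N) ratio a j k / (1 - `|z| ^+ 2 * ratio a j k) *
     (v j + (v k)^*).
  rewrite /fluctuation mulr_sumr exchange_big /=; apply: eq_bigr => j _.
  rewrite mulr_sumr exchange_big /=; apply: eq_bigr => k _.
  under eq_bigr => i _ do rewrite normrM normrX c1 expr1n mul1r.
  rewrite -mulr_sumr [RHS]mulrCA; congr (_ * _). rewrite big_split /= mulrDr.
  rewrite fluct_term_avg //; congr (_ + _).
  by rewrite -rmorph_sum /= fluct_term_avg // rmorphM /= rmorph_nat.
rewrite normrM normr_nat ler_wpM2l //.
apply: le_trans (ler_norm_sum _ _ _) _.
have -> : N%:R ^+ 2 * (rho ^+ M *+ 2 / (1 - rho) ^+ 2) =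
   \sum_(j < N) \sum_(k < N) rho ^+ M *+ 2 / (1 - rho) ^+ 2.
  under [RHS]eq_bigr do rewrite sumr_const card_ord.
  by rewrite sumr_const card_ord -mulrnA -[RHS]mulr_natl natrM expr2.
apply: ler_sum => j _; apply: le_trans (ler_norm_sum _ _ _) _.
apply: ler_sum => k _; rewrite 2!normrM norm_ratio // mul1r normfV.
have d0 : 1 - rho != 0 by rewrite gt_eqF.
have -> : rho ^+ M *+ 2 / (1 - rho) ^+ 2 = (1 - rho)^-1 * ((rho ^+ M / (1 - rho)) *+ 2).
  by field.
apply: ler_pM; rewrite ?invr_ge0 //.
  apply: key; rewrite (normrM (_ ^+ 2)) norm_ratio // mulr1 normrX normr_id.
  by apply: le_trans zr; rewrite expr2 ler_piMr // ltW.
by apply: le_trans (ler_normD _ _) _; rewrite norm_conjC mulr2n; exact: lerD.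
Qed.

(** * Roots of unity as minimizers *)

Variable e : C.
Hypothesis eP : N.-primitive_root e.

Let prim_norm1 : `|e| = 1 := norm_prim_root eP.

Definition roots_of_unity (k : 'I_N) : C := e ^+ k.

Lemma roots_norm1 k : `|roots_of_unity k| = 1.
Proof. by rewrite normrX prim_norm1 expr1n. Qed.

Lemma roots_power_sum (n m : nat) : (n < N)%N -> (m < N)%N ->
  \sum_(k < N) roots_of_unity k ^+ n * (roots_of_unity k)^* ^+ m =
  if n == m then N%:R else 0.
Proof.
move=> nN mN; have e0 : e != 0 by rewrite -normr_gt0 prim_norm1.
have E (k : 'I_N) : roots_of_unity k ^+ n * (roots_of_unity k)^* ^+ m
    = (e ^+ n / e ^+ m) ^+ k.
  rewrite /roots_of_unity rmorphXn /= (conjC_unit prim_norm1) !exprVn expr_div_n.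
  by rewrite -!exprM mulnC; congr (_ / _); rewrite mulnC.
under eq_bigr do rewrite E.
have em0 : e ^+ m != 0 by rewrite expf_neq0.
case: eqP => [->|nm].
  under eq_bigr do rewrite divff // expr1n.
  by rewrite sumr_const card_ord.
apply: geo_root_eq0.
  by rewrite expr_div_n -!exprM ![(_ * N)%N]mulnC !exprM (prim_expr_order eP) !expr1n divr1.
apply/eqP => /divr1_eq/eqP; rewrite (eq_prim_root_expr eP) !modn_small //.
by move/eqP.
Qed.

Lemma roots_ratio_sum (j k : 'I_N) : k != j ->
  \sum_(i < N) ratio roots_of_unity j k ^+ i = 0.
Proof.
move=> kj; have e0 : e != 0 by rewrite -normr_gt0 prim_norm1.
have ej0 : e ^+ j != 0 by rewrite expf_neq0.
have -> : ratio roots_of_unity j k = e ^+ k / e ^+ j.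
  by rewrite /ratio /roots_of_unity rmorphXn /= (conjC_unit prim_norm1) exprVn mulrC.
apply: geo_root_eq0.
  by rewrite expr_div_n -!exprM ![(_ * N)%N]mulnC !exprM (prim_expr_order eP) !expr1n divr1.
apply: contra kj => /eqP/divr1_eq/eqP; rewrite (eq_prim_root_expr eP) !modn_small //.
Qed.

(** Both remainders of [energy_split] vanish. For j <> k the ratio is a nontrivial N-th root of
    unity, which kills [offdiag]. The lengths [ndist i l] are below N, so the power sums in
    [power_formE] have exponents n - m with |n - m| < N and vanish off the diagonal. *)
Lemma energy_roots x : 0 < x < 1 ->
  energy_weight x * pair_energy roots_of_unity x = energy_bound x.
Proof.
move=> x01; have x0 : 0 < x by case/andP: x01.
rewrite energy_split //; last exact: roots_norm1.
have -> : offdiag roots_of_unity x = 0.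
  rewrite /offdiag big1 // => j _; rewrite big1 // => k kj.
  by rewrite roots_ratio_sum // normr0 expr0n mul0r.
rewrite mul0rn addr0 big1 ?addr0 // => i _; rewrite big1 // => l _.
rewrite power_formE //; last exact: roots_norm1.
have dN : (ndist i l < N)%N.
  rewrite /ndist; case: (leqP i l) => [il|/ltnW li].
    by rewrite (eqP il) add0n (leq_ltn_trans (leq_subr _ _)).
  by rewrite (eqP li) addn0 (leq_ltn_trans (leq_subr _ _)).
rewrite /power_bound -sumrB big1 ?mulr0 // => n _.
have nN := ltn_trans (ltn_ord n) dN.
rewrite (bigD1 n) //= roots_power_sum // eqxx normr_nat.
rewrite [X in _ + X - _]big1 ?addr0 ?subrr // => m mn.
have mN := ltn_trans (ltn_ord m) dN.
by rewrite roots_power_sum // eq_sym (negPf (mn : (m != n :> nat))) normr0 expr0n mulr0.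
Qed.

Lemma energy_min a x : (forall k, `|a k| = 1) -> 0 < x < 1 ->
  pair_energy roots_of_unity x <= pair_energy a x.
Proof.
move=> a1 x01; have x0 : 0 < x by case/andP: x01.
rewrite -(ler_pM2l (energy_weight_gt0 (prim_order_gt0 eP) x0)) energy_roots //.
by apply: le_trans (energy_ge a1 x01); rewrite lerDl mulrn_wge0 // offdiag_ge0.
Qed.

(** Equality forces [offdiag] to be 0. It is a sum of nonnegative terms in which the factor |1 - x
    w|^-2 is nonzero, so each geometric sum vanishes. *)
Lemma energy_min_eq a x : (forall k, `|a k| = 1) -> 0 < x < 1 ->
  pair_energy a x = pair_energy roots_of_unity x ->
  forall j k, k != j -> \sum_(i < N) ratio a j k ^+ i = 0.
Proof.
move=> a1 x01 E j k kj; have x0 : 0 < x by case/andP: x01.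
have := energy_ge a1 x01; rewrite E energy_roots // gerDl pmulrn_lle0 // => o0.
have {o0} /eqP : offdiag a x = 0 by apply/eqP; rewrite eq_le o0 offdiag_ge0.
have p j' k' : 0 <= `|\sum_(i < N) ratio a j' k' ^+ i| ^+ 2
      * `|1 - x * ratio a j' k'| ^- 2 by rewrite mulr_ge0 ?invr_ge0 ?exprn_ge0.
rewrite /offdiag psumr_eq0 => [|j' _]; last by apply: sumr_ge0.
move=> /allP /(_ j (mem_index_enum _)) /=; rewrite psumr_eq0 //.
move=> /allP /(_ k (mem_index_enum _)); rewrite kj /= mulf_eq0 invr_eq0 !expf_eq0 /=.
have x01' : 0 <= x < 1 by case/andP: x01 => ? ->; rewrite ltW.
by rewrite !normr_eq0 (negPf (norm1sub_neq0 (norm_ratio j k a1) x01')) orbF => /eqP.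
Qed.

(** If two points coincided, their geometric sum would be N, not 0; so the points are distinct. A
    vanishing geometric sum also gives w^N = 1. Dividing by c = a_0 leaves N distinct N-th roots of
    unity, hence all of them, in the order given by a permutation. *)
Lemma minimizer_roots a : (forall k, `|a k| = 1) ->
  (forall j k, k != j -> \sum_(i < N) ratio a j k ^+ i = 0) ->
  exists c : C, `|c| = 1 /\ exists s : 'S_N, forall k, a k = c * roots_of_unity (s k).
Proof.
move=> a1 H; have N0 := prim_order_gt0 eP; pose c := a (Ordinal N0).
have c1 : `|c| = 1 by exact: a1.
have c0 : c != 0 by rewrite -normr_gt0 c1.
have N0C : N%:R != 0 :> C by rewrite pnatr_eq0 -lt0n.
have inj j k : a j = a k -> j = k.
  move=> ajk; apply/eqP/negPn/negP => jk; have := H _ _ jk.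
  rewrite /ratio ajk mulrC -normCK a1 expr1n.
  under eq_bigr do rewrite expr1n.
  by rewrite sumr_const card_ord => /eqP; rewrite (negPf N0C).
have root k : (a k / c) ^+ N = 1.
  have [->|kc] := eqVneq k (Ordinal N0); first by rewrite divff // expr1n.
  have := H _ _ kc; rewrite /ratio (conjC_unit (a1 _)) mulrC => S0.
  by apply/eqP; rewrite -subr_eq0 subrX1 S0 mulr0.
pose s k := sval (prim_rootP eP (root k)).
have sE k : a k = c * roots_of_unity (s k).
  rewrite /roots_of_unity /s; case: (prim_rootP _ _) => i /= <-.
  by rewrite mulrC divfK.
have s_inj : injective s by move=> j k sjk; apply: inj; rewrite !sE sjk.
by exists c; split=> //; exists (perm s_inj) => k; rewrite permE.
Qed.

(** * From the pair energy to the circular mean *)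

Lemma conj_ratio a j k : (ratio a j k)^* = ratio a k j.
Proof. by rewrite /ratio rmorphM /= conjCK mulrC. Qed.

Lemma conj_mean_energy a x : x \is Num.real -> (mean_energy a x)^* = mean_energy a x.
Proof.
move=> xr; rewrite /mean_energy rmorph_sum /=.
under eq_bigr do rewrite rmorph_sum /=.
rewrite exchange_big /=; apply: eq_bigr => j _; apply: eq_bigr => k _.
by rewrite fmorph_div rmorphB rmorph1 (rmorphM _ x) /= (conj_Creal xr) !conj_ratio.
Qed.

(** As x m(x) is real, its double is its sum with its conjugate. Termwise this is the Poisson kernel
    identity 2 Re (u/(1 - u)) = (1 - |u|^2)/|1 - u|^2 - 1 with u = x w_jk, and the N^2 terms -1 add
    up to -N^2. *)
Lemma mean_energyE a x : (forall k, `|a k| = 1) -> 0 <= x < 1 ->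
  (x * mean_energy a x) *+ 2 = (1 - x ^+ 2) * pair_energy a x - N%:R ^+ 2.
Proof.
move=> a1 x01; have xr : x \is Num.real by case/andP: x01 => ? _; rewrite ger0_real.
have cE : (x * mean_energy a x)^* = x * mean_energy a x.
  by rewrite rmorphM /= (conj_Creal xr) conj_mean_energy.
rewrite mulr2n -{2}cE.
have -> : N%:R ^+ 2 = \sum_(j < N) \sum_(k < N) (1 : C).
  under eq_bigr do rewrite sumr_const card_ord.
  by rewrite sumr_const card_ord -[RHS]mulr_natr expr2.
rewrite /mean_energy /pair_energy !mulr_sumr rmorph_sum /= -big_split -sumrB /=.
apply: eq_bigr => j _; rewrite !mulr_sumr rmorph_sum /= -big_split -sumrB /=.
apply: eq_bigr => k _; have w1 := norm_ratio j k a1.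
have w0 : ratio a j k != 0 by rewrite -normr_gt0 w1.
have d0 := norm1sub_neq0 w1 x01.
have d0' : (1 - x * ratio a j k)^* != 0 by rewrite conjC_eq0.
rewrite normCK (rmorphM _ x) fmorph_div /=; move: d0'.
rewrite rmorphB rmorph1 (rmorphM _ x) /= (conj_Creal xr) (conjC_unit w1) => d0'.
move: d0'; have -> : 1 - x / ratio a j k = (ratio a j k - x) / ratio a j k.
  by rewrite mulrBl divff.
rewrite mulf_eq0 negb_or => /andP[d1 _].
by field; rewrite w0 d0 d1.
Qed.

Lemma mean_energy_min a x : (forall k, `|a k| = 1) -> 0 < x < 1 ->
  mean_energy roots_of_unity x <= mean_energy a x.
Proof.
move=> a1 x01; have /andP[x0 x1] := x01.
have x01' : 0 <= x < 1 by rewrite ltW.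
rewrite -(ler_pM2l x0) -(ler_pMn2r (n:=2)) // !mean_energyE //; last exact: roots_norm1.
rewrite lerD2r; apply: ler_wpM2l; last exact: energy_min.
by rewrite subr_ge0 expr_le1 // ltW.
Qed.

Lemma mean_energy_min_eq a x : (forall k, `|a k| = 1) -> 0 < x < 1 ->
  mean_energy a x = mean_energy roots_of_unity x ->
  exists c : C, `|c| = 1 /\ exists s : 'S_N, forall k, a k = c * roots_of_unity (s k).
Proof.
move=> a1 x01 E; apply: minimizer_roots => //.
apply: (energy_min_eq a1 x01); have /andP[x0 x1] := x01.
have x01' : 0 <= x < 1 by rewrite ltW.
have : (x * mean_energy a x) *+ 2 = (x * mean_energy roots_of_unity x) *+ 2 by rewrite E.
rewrite !mean_energyE //; last exact: roots_norm1.
move/addIr; apply: mulfI; rewrite subr_eq0 eq_sym.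
by rewrite lt_eqF // expr_lt1 // ltW.
Qed.

(** The centre is treated apart because the energy argument divides by x. There the mean is |sum_k
    a_k|^2, which is 0 for the roots of unity if N > 1 and is 1 for any unit point if N = 1. *)
Lemma mean_energy_min0 a : (forall k, `|a k| = 1) ->
  mean_energy roots_of_unity 0 <= mean_energy a 0.
Proof.
have E b : mean_energy b 0 = `|\sum_(k < N) b k| ^+ 2.
  rewrite normCKC rmorph_sum /= mulr_suml; apply: eq_bigr => j _.
  by rewrite mulr_sumr; apply: eq_bigr => k _; rewrite mul0r subr0 divr1.
move=> a1; rewrite !E; case: (ltnP 1 N) => N1.
  have := roots_power_sum N1 (prim_order_gt0 eP).
  under eq_bigr do rewrite expr0 mulr1 expr1.
  by move=> ->; rewrite normr0 expr0n exprn_ge0.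
suff E1 (b : 'I_N -> C) : (forall k, `|b k| = 1) -> `|\sum_(k < N) b k| = 1.
  by rewrite !E1 //; exact: roots_norm1.
move=> b1; rewrite (bigD1 (Ordinal (prim_order_gt0 eP))) //= big1 ?addr0 // => k.
by have := leq_trans (ltn_ord k) N1; rewrite ltnS leqn0 -val_eqE /= => /eqP ->.
Qed.

End Algebra.

Local Open Scope complex_scope.
Local Notation Re := complex.Re.
Local Notation Im := complex.Im.

(** * Lebesgue measure in the plane *)

Definition image_measure d d' (T1 : measurableType d) (T2 : measurableType d')
    (R : realType) (m : measure T1 R) (f : T1 -> T2)
    (mf : measurable_fun setT f) : measure T2 R :=
  measure_function_pushforward__canonical__measure_function_Measure m mf.

Section PlaneMeasure.
Context {R : realType}.
Notation mu := (@lebesgue_measure R).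
Notation RT := (measurableTypeR R).
Notation mu2 := (mu \x mu)%E.

Lemma measurable_affine (c t : R) :
  measurable_fun (T := RT) (U := RT) setT (fun y : R => c * y + t).
Proof. by apply: measurable_funD => //; exact: mulrl_measurable. Qed.

(** Both sides are measures in [B] that agree on half-open intervals. The case c = 1 serves shears,
    the case t = 0 dilations. *)
Lemma lebesgue_affine (c t : R) (B : set RT) : 0 < c -> measurable B ->
  (c%:E * mu ((fun y : R => (c * y + t)%R) @^-1` B))%E = mu B.
Proof.
move=> c0 mB; have c0' : 0 <= c by exact: ltW.
suff -> : mu B = mscale (NngNum c0') (image_measure mu (measurable_affine c t)) B by [].
apply: lebesgue_measure_unique => // _ [[a b]] _ <-.
transitivity (c%:E * mu ((fun y : R => (c * y + t)%R) @^-1` `]a, b]))%E => //.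
have -> : (fun y : R => c * y + t) @^-1` `]a, b] = `](a - t) / c, (b - t) / c]%classic.
  apply/seteqP; split => y /=; rewrite !in_itv /= ltr_pdivrMr // ler_pdivlMr //;
  by rewrite ltrBlDr lerBrDr ![y * c]mulrC.
rewrite !lebesgue_measure_itv /= !lte_fin ltr_pM2r ?invr_gt0 // ltrD2r.
case: ifPn => _; last by rewrite mule0.
rewrite -!EFinB -EFinM; congr (_%:E); field; exact: lt0r_neq0.
Qed.

Lemma measurable_preimage d d' (T : measurableType d) (T' : measurableType d')
  (f : T -> T') (X : set T') : measurable_fun setT f -> measurable X ->
  measurable (f @^-1` X).
Proof. by move=> mf mX; rewrite -[X in measurable X]setTI; exact: mf. Qed.

Definition area_preserving (f : RT * RT -> RT * RT) :=
  measurable_fun setT f /\ forall X, measurable X -> mu2 (f @^-1` X) = mu2 X.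

Lemma area_preserving_comp f g : area_preserving f -> area_preserving g ->
  area_preserving (f \o g).
Proof.
move=> [mf f2] [mg g2]; split; first exact: measurableT_comp.
by move=> X mX; rewrite comp_preimage g2 ?f2 //; exact: measurable_preimage.
Qed.

Lemma area_preserving_swap : area_preserving (@swap_pair RT RT).
Proof.
split=> [|X mX]; first exact: measurable_swap.
apply/esym.
apply: (product_measure_unique (m' := image_measure mu2 (@measurable_swap _ _ RT RT))) => //.
move=> A B mA mB; rewrite /= /pushforward.
have -> : @swap_pair RT RT @^-1` (A `*` B) = B `*` A.
  by apply/seteqP; split => -[x y] /= [].
by rewrite product_measure1E // muleC.
Qed.

Definition shear (s : R) (p : RT * RT) : RT * RT := (p.1, s * p.1 + p.2).

(** Fubini: each vertical section of the preimage is a translate of the corresponding section of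
    [X]. *)
Lemma area_preserving_shear s : area_preserving (shear s).
Proof.
split=> [|X mX].
  apply: measurable_fun_pair; first exact: measurable_fst.
  apply: measurable_funD; last exact: measurable_snd.
  by apply: measurable_funM => //; exact: measurable_fst.
apply: eq_integral => x _ /=.
have -> : xsection (shear s @^-1` X) x = (fun y : R => 1 * y + s * x) @^-1` (xsection X x).
  apply/seteqP; split => y; rewrite /xsection /= !inE /shear /=;
  by rewrite mul1r [y + _]addrC.
by rewrite -[LHS]mul1e; apply: lebesgue_affine => //; exact: measurable_xsection.
Qed.

Definition rot (c : R * R) (p : RT * RT) : RT * RT :=
  (c.1 * p.1 - c.2 * p.2, c.2 * p.1 + c.1 * p.2).

(* A rotation of angle [t <> pi] is the product of three shears, of slopes
   [tan (t / 2)], [sin t] and [tan (t / 2)]. *)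
Lemma area_preserving_rot c : c.1 ^+ 2 + c.2 ^+ 2 = 1 -> area_preserving (rot c).
Proof.
wlog c0 : c / 1 + c.1 != 0.
  move=> W c1; have [c0|] := eqVneq (1 + c.1) 0; last by move=> ?; exact: W.
  have c1N : c.1 = -1 by rewrite -(addKr 1 c.1) c0 addr0.
  have c20 : c.2 = 0.
    move: c1; rewrite c1N sqrrN expr1n => /(canRL (addKr _)); rewrite addNr.
    by move=> /eqP; rewrite sqrf_eq0 => /eqP.
  (* The half turn is the square of a quarter turn, for which 1 + c.1 = 1. *)
  have -> : rot c = rot (0, 1) \o rot (0, 1).
    by apply/funext => -[x y]; rewrite /rot /= c1N c20; congr pair; ring.
  by apply: area_preserving_comp; apply: W; rewrite /= ?addr0 ?oner_eq0 // expr0n add0r expr1n.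
move=> c1; pose tn := c.2 / (1 + c.1).
have h1 : tn * c.2 = 1 - c.1.
  rewrite /tn mulrAC -expr2 -[1 - c.1](mulfK c0); congr (_ / _).
  by rewrite -[RHS]subr_sqr expr1n -c1 addrAC subrr add0r.
have h2 : tn * (1 + c.1) = c.2 by rewrite divfK.
have -> : rot c = (@swap_pair RT RT \o shear (- tn) \o @swap_pair RT RT) \o shear c.2 \o
    (@swap_pair RT RT \o shear (- tn) \o @swap_pair RT RT).
  apply/funext => -[x y]; rewrite /rot /shear /swap_pair /=.
  have e2 : c.2 * (- tn * y + x) + y = c.2 * x + c.1 * y.
    have -> : c.1 = 1 - tn * c.2 by rewrite h1; ring.
    by ring.
  rewrite e2; congr pair; apply/eqP; rewrite -subr_eq0; apply/eqP.
  transitivity (x * (tn * c.2 - (1 - c.1)) + y * (tn * (1 + c.1) - c.2)); first ring.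
  by rewrite h1 h2 !subrr !mulr0 addr0.
have pS : area_preserving (@swap_pair RT RT \o shear (- tn) \o @swap_pair RT RT).
  exact: (area_preserving_comp (area_preserving_comp area_preserving_swap
    (area_preserving_shear _)) area_preserving_swap).
exact: (area_preserving_comp (area_preserving_comp pS (area_preserving_shear c.2)) pS).
Qed.

(** * Areas of disks and the distribution of 1 - |z|^2 *)

Definition dilation (c : R) (p : RT * RT) : RT * RT := (c * p.1, c * p.2).

Lemma measurable_dilation c : measurable_fun setT (dilation c).
Proof.
apply: measurable_fun_pair.
  by apply: measurable_funM => //; exact: measurable_fst.
by apply: measurable_funM => //; exact: measurable_snd.
Qed.

Lemma product_dilation (c : R) (X : set (RT * RT)) : 0 < c -> measurable X ->
  (c%:E * (c%:E * mu2 (dilation c @^-1` X)))%E = mu2 X.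
Proof.
move=> c0 mX; have c0' : 0 <= c by exact: ltW.
suff -> : mu2 X = mscale (NngNum c0')
  (mscale (NngNum c0') (image_measure mu2 (measurable_dilation c))) X by [].
apply: product_measure_unique => // A B mA mB.
transitivity (c%:E * (c%:E * mu2 (dilation c @^-1` (A `*` B))))%E => //.
have -> : dilation c @^-1` (A `*` B) =
    ((fun y : R => c * y + 0) @^-1` A) `*` ((fun y : R => c * y + 0) @^-1` B).
  by apply/seteqP; split => -[x y] /=; rewrite !addr0.
transitivity (c%:E * (c%:E * (mu ((fun y : R => (c * y + 0)%R) @^-1` A) *
                              mu ((fun y : R => (c * y + 0)%R) @^-1` B))))%E.
  do 2 congr (_ * _)%E; apply: product_measure1E.
  - exact: (measurable_preimage (measurable_affine c 0) mA).
  - exact: (measurable_preimage (measurable_affine c 0) mB).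
transitivity (mu A * mu B)%E => //.
rewrite -(lebesgue_affine 0 c0 mA) -(lebesgue_affine 0 c0 mB).
by rewrite [RHS]muleACA -[RHS]muleA.
Qed.

Definition sqnorm (p : RT * RT) : R := p.1 ^+ 2 + p.2 ^+ 2.
Definition depth (p : RT * RT) : R := 1 - sqnorm p.

Lemma measurable_sqnorm : measurable_fun setT sqnorm.
Proof.
apply: measurable_funD; apply: measurable_funX.
  exact: measurable_fst.
exact: measurable_snd.
Qed.

Lemma measurable_depth : measurable_fun (U := RT) setT depth.
Proof. by apply: measurable_funB => //; exact: measurable_sqnorm. Qed.

Lemma sqnorm_rot c p : c.1 ^+ 2 + c.2 ^+ 2 = 1 -> sqnorm (rot c p) = sqnorm p.
Proof.
move=> c1; rewrite /sqnorm /rot /=; transitivity ((c.1 ^+ 2 + c.2 ^+ 2) * (p.1 ^+ 2 + p.2 ^+ 2)).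
  by ring.
by rewrite c1 mul1r.
Qed.

(** The parameter is the square of the radius, which makes the area linear in it. *)
Definition disk (s : R) : set (RT * RT) := [set p | sqnorm p < s].

Lemma measurable_disk s : measurable (disk s).
Proof.
rewrite [X in measurable X](_ : _ = sqnorm @^-1` `]-oo, s[); last first.
  by apply/seteqP; split => p /=; rewrite /disk /= in_itv /=.
by apply: measurable_preimage; [exact: measurable_sqnorm|exact: measurable_itv].
Qed.

(** This is pi, kept as an abstract constant. Finiteness and positivity follow from a square around
    the disk and one inside it. *)
Definition disk_area : R := fine (mu2 (disk 1)).

Lemma mu2_disk1 : mu2 (disk 1) = disk_area%:E.
Proof.
rewrite fineK // ge0_fin_numE ?measure_ge0 //.
apply: (@le_lt_trans _ _ (mu2 (`[(-1)%R, 1%R]%classic `*` `[(-1)%R, 1%R]%classic))).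
  apply: le_measure; rewrite ?inE; [exact: measurable_disk|exact: measurableX|].
  move=> p; rewrite /disk /sqnorm /= => p1; rewrite !in_itv /= -!ler_norml.
  have h (x y : R) : x ^+ 2 + y ^+ 2 < 1 -> `|x| <= 1.
    move=> xy; rewrite leNgt; apply/negP => x1.
    have : 1 < `|x| ^+ 2 by rewrite expr_gt1 //.
    by rewrite real_normK ?num_real //; have := sqr_ge0 y; lra.
  by split; [exact: (h _ p.2)|apply: (h _ p.1); rewrite addrC].
rewrite [ltLHS](_ : _ = (mu `[(-1)%R, 1%R] * mu `[(-1)%R, 1%R])%E); last exact: product_measure1E.
rewrite lebesgue_measure_itv /= lte_fin.
by case: ifP => _; rewrite ?mule0 ?ltry // -EFinB -EFinM ltry.
Qed.

Lemma disk_area_gt0 : 0 < disk_area.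
Proof.
rewrite -lte_fin -mu2_disk1.
apply: (@lt_le_trans _ _ (mu2 (`[0%R, (2^-1)%R]%classic `*` `[0%R, (2^-1)%R]%classic))).
  rewrite [ltRHS](_ : _ = (mu `[0%R, (2^-1)%R] * mu `[0%R, (2^-1)%R])%E); last exact: product_measure1E.
  by rewrite lebesgue_measure_itv /= lte_fin invr_gt0 ltr0n -EFinB -EFinM lte_fin subr0 mulr_gt0 // invr_gt0.
apply: le_measure; rewrite ?inE; [exact: measurableX|exact: measurable_disk|].
move=> p [] /=; rewrite !in_itv /= /disk /sqnorm /= => /andP[a b] /andP[c d].
have h (x : R) : 0 <= x -> x <= 2^-1 -> x ^+ 2 <= 4^-1.
  by move=> x0 x1; have := ler_pM x0 x0 x1 x1; rewrite -expr2; lra.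
by have := h _ a b; have := h _ c d; lra.
Qed.

Lemma mu2_disk (s : R) : mu2 (disk s) = (disk_area * Num.max s 0)%:E.
Proof.
have [s0|s0] := ltP 0 s; last first.
  rewrite (_ : disk s = set0) ?measure0 ?mulr0 //.
  apply/seteqP; split => // p; rewrite /disk /sqnorm /= => h.
  by have := le_lt_trans (addr_ge0 (sqr_ge0 p.1) (sqr_ge0 p.2)) h; rewrite ltNge s0.
have r0 : 0 < Num.sqrt s by rewrite sqrtr_gt0.
rewrite -(product_dilation r0 (measurable_disk s)).
have -> : dilation (Num.sqrt s) @^-1` (disk s) = disk 1.
  apply/seteqP; split => p; rewrite /disk /dilation /sqnorm /= !exprMn -mulrDr sqr_sqrtr ?ltW //;
  by rewrite gtr_pMr.
by rewrite mu2_disk1 -!EFinM mulrA -expr2 sqr_sqrtr ?(ltW s0) // mulrC.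
Qed.

(** This stands in for polar coordinates: the area of a disk is linear in its squared radius, so the
    preimage of []a, b]] under [depth], a difference of two disks, has area proportional to b - a
    when b <= 1. *)
Lemma image_depth (B : set RT) : measurable B -> B `<=` `]-oo, 1] ->
  mu2 (depth @^-1` B) = (disk_area%:E * mu B)%E.
Proof.
move=> mB B1; have k0 := disk_area_gt0.
have k0' : 0 <= disk_area^-1 by rewrite invr_ge0 ltW.
have mI : measurable (`]1%R, +oo[%classic : set RT) by exact: measurable_itv.
(* [lebesgue_measure_unique] compares measures on the whole line, whence the
   extra mass on ]1, +oo[, where the image under [depth] vanishes. *)
pose nu := measure_add (mscale (NngNum k0') (image_measure mu2 measurable_depth)) (mrestr mu mI).
have nuE A : nu A = (disk_area^-1%:E * mu2 (depth @^-1` A) + mu (A `&` `]1%R, +oo[))%E.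
  by rewrite /nu measure_addE.
have E : mu B = nu B.
  apply: lebesgue_measure_unique => // _ [[a b]] _ <-.
  apply: etrans (esym (nuE _)); rewrite /=; have [ba|ab] := leP b a.
    by rewrite set_itv_ge ?bnd_simp -?leNgt // preimage_set0 set0I !measure0 mule0 adde0.
  have -> : depth @^-1` `]a, b] = disk (1 - a) `\` disk (1 - b).
    apply/seteqP; split => p; rewrite /disk /depth /= in_itv /=.
      by move=> /andP[pa pb]; split; [lra|apply/negP; rewrite -leNgt; lra].
    by move=> [pa /negP]; rewrite -leNgt => pb; apply/andP; split; lra.
  have -> : `]a, b] `&` `]1%R, +oo[ = `]Num.max a 1, b]%classic.
    apply/seteqP; split => x; rewrite /= !in_itv /= ?andbT gt_max.
      by move=> [/andP[-> ->] ->].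
    by move=> /andP[/andP[-> ->] ->].
  have fin : (mu2 (disk (1 - a)) < +oo)%E by rewrite mu2_disk ltry.
  have -> : mu2 (disk (1 - a) `\` disk (1 - b)) = (mu2 (disk (1 - a)) - mu2 (disk (1 - b)))%E.
    have {2}-> : disk (1 - b) = disk (1 - a) `&` disk (1 - b).
      apply/seteqP; split => p; rewrite /disk /=; last by case.
      by move=> h; split => //; apply: lt_trans h _; rewrite ltrD2l ltrN2.
    by apply: measureD => //; exact: measurable_disk.
  rewrite !mu2_disk !lebesgue_measure_itv /= !lte_fin ab -!EFinB -EFinM -mulrBr mulKf ?gt_eqF //.
  (* What remains is max(1 - a, 0) - max(1 - b, 0) + max(b - max(a, 1), 0) = b - a for a < b, by
     cases on the position of 1. *)
  case: ifPn; rewrite -?leNgt => h; rewrite ?adde0 -?EFinD; congr (_%:E); move: h.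
    rewrite /Num.max; do ! case: ifPn; rewrite -?leNgt; lra.
  rewrite /Num.max; do ! case: ifPn; rewrite -?leNgt; lra.
rewrite E [nu B]nuE.
have -> : B `&` `]1%R, +oo[ = set0.
  apply/seteqP; split => // x [/B1]; rewrite /= !in_itv /= andbT => h1 h2.
  by have := lt_le_trans h2 h1; rewrite ltxx.
by rewrite measure0 adde0 muleA -EFinM divff ?gt_eqF // mul1e.
Qed.

End PlaneMeasure.

(** * The completed area *)

Section Completion.
Context {R : realType}.
Notation mu := (@lebesgue_measure R).
Notation RT := (measurableTypeR R).
Notation mu2 := (mu \x mu)%E.
Definition area_type : measurableType _ := caratheodory_type (mu2^*)%mu.

Lemma area_borel (X : set (RT * RT)) : measurable X -> @area R X = mu2 X.
Proof. by move=> mX; rewrite /area /completed_measure_extension measurable_mu_extE. Qed.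

Lemma borel_area_measurable (X : set (RT * RT)) : measurable X ->
  measurable (X : set area_type).
Proof. exact: caratheodory_measurable_mu_ext. Qed.

Lemma measurable_fun_area d (T : measurableType d) (D : set (RT * RT)) (f : RT * RT -> T) :
  measurable D -> measurable_fun D f -> measurable_fun (D : set area_type) (f : area_type -> T).
Proof.
by move=> mD mf _ Y mY; apply: borel_area_measurable; exact: mf.
Qed.

(** For an arbitrary set, [area] is the infimum of the total measures of Borel covers, and pulling a
    cover of X back by f gives a cover of the preimage with the same total. *)
Lemma area_preimage_le f (X : set (RT * RT)) : @area_preserving R f ->
  (@area R (f @^-1` X) <= @area R X)%E.
Proof.
move=> [mf f2]; apply: le_ereal_inf_tmp => _ [F [mF XF] <-].
apply: ereal_inf_lbound; exists (fun n => f @^-1` (F n)); last first.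
  by apply: eq_eseriesr => n _; exact: f2 (mF n).
split=> [n|]; first exact: (measurable_preimage mf (mF n)).
by rewrite -preimage_bigcup; exact: preimage_subset.
Qed.

Lemma area_preimage f g (X : set (RT * RT)) : cancel f g -> cancel g f ->
  @area_preserving R f -> @area_preserving R g ->
  @area R (f @^-1` X) = @area R X.
Proof.
move=> fK gK pf pg; apply/eqP; rewrite eq_le area_preimage_le //=.
have {1}-> : X = g @^-1` (f @^-1` X).
  by apply/seteqP; split => p /=; rewrite gK.
exact: area_preimage_le.
Qed.

(** The outer measure is invariant under f and g, so splitting a test set X along the preimage of Y
    amounts to splitting the preimage of X under g along Y. *)
Lemma measurable_fun_area_preserving f g : cancel f g -> cancel g f ->
  @area_preserving R f -> @area_preserving R g ->
  measurable_fun [set: area_type] (f : area_type -> area_type).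
Proof.
move=> fK gK pf pg _ Y mY; rewrite setTI.
have {}mY : (mu2^*)%mu.-cara.-measurable Y := mY.
suff : (mu2^*)%mu.-cara.-measurable (f @^-1` Y) by []; move=> X.
have E Z : (mu2^*)%mu (f @^-1` Z) = (mu2^*)%mu Z by exact: (area_preimage Z fK gK).
have E' Z : (mu2^*)%mu (g @^-1` Z) = (mu2^*)%mu Z by exact: (area_preimage Z gK fK).
apply: etrans (esym (E' X)) _; apply: etrans (mY (g @^-1` X)) _.
congr (_ + _)%E; apply: etrans (esym (E _)) _; congr ((mu2^*)%mu _);
by apply/seteqP; split => p /=; rewrite fK.
Qed.

Lemma area_null_measurable (N M : set (RT * RT)) : measurable M -> mu2 M = 0%E ->
  N `<=` M -> measurable (N : set area_type).
Proof.
move=> mM M0 NM.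
have N0 : (mu2^*)%mu N = 0%E.
  apply/eqP; rewrite eq_le outer_measure_ge0 andbT -M0 -area_borel //.
  exact: le_outer_measure.
apply: le_caratheodory_measurable => /= X.
apply: (@le_trans _ _ ((mu2^*)%mu N + (mu2^*)%mu (X `&` ~` N))%E).
  by rewrite leeD2r// le_outer_measure//; exact: subIsetr.
by rewrite N0 add0e// le_outer_measure//; exact: subIsetl.
Qed.

(** Composing a Lebesgue measurable [g] with a Borel map is delicate, as preimages of null sets must
    be null. The preimage of Y under g in [0, 1] is a Borel set A together with a part N of a Borel
    null set M. The [depth] preimage of A is Borel, and by [image_depth] that of N lies in a null
    set within the disk. *)
Lemma measurable_fun_depth (g : R -> R) :
  (forall Y, measurable Y ->
    ((@wlength R idfun)^*)%mu.-cara.-measurable (`[0, 1] `&` g @^-1` Y)) ->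
  measurable_fun (disk 1 : set area_type) (fun p => g (depth p)).
Proof.
move=> mg mD Y mY.
have := mg Y mY; rewrite -completed_caratheodory_measurable.
rewrite g_sigma_completed_algebra_genE => -[/= A mA [N [M [mM M0 NM]] EAN]].
have d01 p : disk 1 p -> 0 <= (depth p : R) <= 1.
  rewrite /disk /depth /= => p1; rewrite subr_ge0 ltW //=.
  by rewrite lerBlDr lerDl addr_ge0 // sqr_ge0.
have I1 : measurable (`]-oo, 1%R] : set RT) by exact: measurable_itv.
have -> : disk 1 `&` (fun p => g (depth p)) @^-1` Y =
  disk 1 `&` (depth @^-1` A `|` (disk 1 `&` depth @^-1` N)).
  apply/seteqP; split => p /= [p1 h].
    have : (`[0, 1] `&` g @^-1` Y) (depth p) by split => //; rewrite /= in_itv /= d01.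
    by rewrite -EAN => -[hA|hN]; split => //; [left|right].
  split => //; suff : (`[0, 1] `&` g @^-1` Y) (depth p) by case.
  by rewrite -EAN; case: h => [|[]]; [left|right].
apply: measurableI => //; apply: measurableU.
  by apply: borel_area_measurable; apply: (measurable_preimage measurable_depth mA).
apply: (@area_null_measurable _ (depth @^-1` (M `&` `]-oo, 1]))).
- by apply: (measurable_preimage measurable_depth); exact: measurableI.
- rewrite image_depth //; last exact: measurableI.
  rewrite (_ : mu _ = 0%E) ?mule0 //.
  by apply: (subset_measure0 (B := M)) => //; exact: measurableI.
- move=> p [p1 Np] /=; split; first exact: NM.
  by rewrite in_itv /=; case/andP: (d01 _ p1).
Qed.

Lemma rotK c : c.1 ^+ 2 + c.2 ^+ 2 = 1 -> cancel (@rot R c) (rot (c.1, - c.2)).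
Proof.
move=> c1 [x y]; rewrite /rot /=; congr pair.
  by transitivity ((c.1 ^+ 2 + c.2 ^+ 2) * x); [ring|rewrite c1 mul1r].
by transitivity ((c.1 ^+ 2 + c.2 ^+ 2) * y); [ring|rewrite c1 mul1r].
Qed.

Lemma rotKV c : c.1 ^+ 2 + c.2 ^+ 2 = 1 -> cancel (rot (c.1, - c.2)) (@rot R c).
Proof.
move=> c1; have -> : rot c = rot ((c.1, - c.2).1, - (c.1, - c.2).2).
  by rewrite /= opprK; case: (c).
by apply: rotK; rewrite /= sqrrN.
Qed.

Section rotation.
Variable c : R * R.
Hypothesis c1 : c.1 ^+ 2 + c.2 ^+ 2 = 1.

Let c1N : (c.1, - c.2).1 ^+ 2 + (c.1, - c.2).2 ^+ 2 = 1.
Proof. by rewrite /= sqrrN. Qed.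

Lemma measurable_fun_area_rot :
  measurable_fun [set: area_type] (rot c : area_type -> area_type).
Proof.
apply: (measurable_fun_area_preserving (rotK c1) (rotKV c1));
  exact: area_preserving_rot.
Qed.

Lemma integral_rot (f : area_type -> \bar R) :
  (@area R).-integrable setT f -> (@area R).-integrable setT (f \o rot c) ->
  (\int[@area R]_p f (rot c p) = \int[@area R]_p f p)%E.
Proof.
move=> fi fri.
have mf : measurable_fun setT f by case/integrableP: fi.
have := integral_pushforward measurable_fun_area_rot mf (mu := @area R) (D := setT).
rewrite preimage_setT => /(_ fri measurableT) <-.
have rE X : measurable X -> X `<=` setT ->
    image_measure (@area R) measurable_fun_area_rot X = @area R X.
  by move=> _ _; apply: (area_preimage X (rotK c1) (rotKV c1)); exact: area_preserving_rot.
exact: (@eq_measure_integral _ area_type R setT (@area R)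
  (image_measure (@area R) measurable_fun_area_rot) f rE).
Qed.

End rotation.

End Completion.

(** * Circular means *)

Section Bridge.
Context {R : realType}.
Notation C := R[i].
Notation RT := (measurableTypeR R).
Implicit Types (z : C) (p : RT * RT).

Lemma norm_normc z : `|z| = (normc z)%:C.
Proof. by []. Qed.

Lemma sqr_normcE z : normc z ^+ 2 = Re z ^+ 2 + Im z ^+ 2.
Proof. by case: z => x y /=; rewrite sqr_sqrtr // addr_ge0 // sqr_ge0. Qed.

Lemma sqr_normc_cplx p : normc (cplx p) ^+ 2 = sqnorm p.
Proof. by rewrite sqr_normcE. Qed.

Lemma sqr_norm_cplx p : `|cplx p| ^+ 2 = (sqnorm p)%:C.
Proof. by rewrite norm_normc -sqr_normc_cplx rmorphXn. Qed.

Lemma unit_disk_disk : @unit_disk R = disk 1.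
Proof.
apply/seteqP; split => p; rewrite /unit_disk /disk /= -sqr_normc_cplx;
by rewrite expr_lt1 // sqrtr_ge0.
Qed.

Definition rotc (c : C) : RT * RT -> RT * RT := rot (Re c, Im c).

Lemma cplx_rotc c p : cplx (rotc c p) = c * cplx p.
Proof.
case: c p => a b [x y]; rewrite /cplx /rotc /rot /=; apply/eqP.
by rewrite eq_complex /= [a * y + _]addrC !eqxx.
Qed.

Definition cmeasurable d (T : measurableType d) (D : set T) (f : T -> C) :=
  measurable_fun D (fun x => Re (f x)) /\ measurable_fun D (fun x => Im (f x)).

Section cmeasurable.
Context d (T : measurableType d) (D : set T).
Implicit Types f g : T -> C.

Lemma cmeasurable_cst c : cmeasurable D (cst c).
Proof. by split; exact: measurable_cst. Qed.

Lemma cmeasurableD f g : cmeasurable D f -> cmeasurable D g ->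
  cmeasurable D (fun x => f x + g x).
Proof.
move=> [f1 f2] [g1 g2]; split.
  by under eq_fun do rewrite raddfD; exact: measurable_funD.
by under eq_fun do rewrite raddfD; exact: measurable_funD.
Qed.

Lemma cmeasurableN f : cmeasurable D f -> cmeasurable D (fun x => - f x).
Proof.
move=> [f1 f2]; split.
  by under eq_fun do rewrite raddfN; exact: measurable_funN.
by under eq_fun do rewrite raddfN; exact: measurable_funN.
Qed.

Lemma cmeasurableM f g : cmeasurable D f -> cmeasurable D g ->
  cmeasurable D (fun x => f x * g x).
Proof.
move=> [f1 f2] [g1 g2]; split.
  rewrite (_ : (fun x => _) = fun x => Re (f x) * Re (g x) - Im (f x) * Im (g x)).
    by apply: measurable_funB; exact: measurable_funM.
  by apply/funext => x; case: (f x) (g x) => ? ? [].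
rewrite (_ : (fun x => _) = fun x => Re (f x) * Im (g x) + Im (f x) * Re (g x)).
  by apply: measurable_funD; exact: measurable_funM.
by apply/funext => x; case: (f x) (g x) => ? ? [].
Qed.

Lemma cmeasurableV f : cmeasurable D f -> cmeasurable D (fun x => (f x)^-1).
Proof.
move=> [f1 f2].
have h : measurable_fun D (fun x => (Re (f x) ^+ 2 + Im (f x) ^+ 2)^-1).
  (* The reciprocal is a power of exponent -1, also at 0, where both are 0 by convention. *)
  rewrite (_ : (fun x => _) = fun x => (Re (f x) ^+ 2 + Im (f x) ^+ 2) `^ (-1)).
    apply: (measurableT_comp (measurable_powR (-1))).
    by apply: measurable_funD; exact: measurable_funX.
  by apply/funext => x; rewrite powR_inv1 // addr_ge0 // sqr_ge0.
split.
  rewrite (_ : (fun x => _) = fun x => Re (f x) * (Re (f x) ^+ 2 + Im (f x) ^+ 2)^-1).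
    exact: measurable_funM.
  by apply/funext => x; case: (f x).
rewrite (_ : (fun x => _) = fun x => - Im (f x) * (Re (f x) ^+ 2 + Im (f x) ^+ 2)^-1).
  by apply: measurable_funM => //; exact: measurable_funN.
by apply/funext => x; case: (f x) => ? ? /=; rewrite mulNr.
Qed.

Lemma cmeasurable_sum (I : Type) (s : seq I) (f : I -> T -> C) :
  (forall i, cmeasurable D (f i)) -> cmeasurable D (fun x => \sum_(i <- s) f i x).
Proof.
move=> mf; elim: s => [|i s IH].
  by under eq_fun do rewrite big_nil; exact: cmeasurable_cst.
by under eq_fun do rewrite big_cons; exact: cmeasurableD.
Qed.

Lemma measurable_sqr_normc f : cmeasurable D f ->
  measurable_fun D (fun x => normc (f x) ^+ 2).
Proof.
move=> [f1 f2]; under eq_fun do rewrite sqr_normcE.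
by apply: measurable_funD; exact: measurable_funX.
Qed.
End cmeasurable.

Lemma cmeasurable_cplx : cmeasurable [set: RT * RT] (@cplx R).
Proof. by split; [exact: measurable_fst|exact: measurable_snd]. Qed.

Variables (N : nat) (a : 'I_N -> C).

Definition cauchy_density p : R := normc (cauchy_sum a (cplx p)) ^+ 2.
Definition mean_density p : R := Re (mean_energy a (sqnorm p)%:C).
Definition fluct_density p : R := Re (fluctuation a (cplx p)).

Lemma measurable_cauchy_density : measurable_fun [set: RT * RT] cauchy_density.
Proof.
apply: measurable_sqr_normc; apply: cmeasurable_sum => k; apply: cmeasurableV.
apply: cmeasurableD; first exact: cmeasurable_cplx.
exact: cmeasurable_cst.
Qed.

Lemma measurable_mean_density : measurable_fun [set: RT * RT] mean_density.
Proof.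
suff [] : cmeasurable [set: RT * RT] (fun p => mean_energy a (sqnorm p)%:C) by [].
apply: cmeasurable_sum => j; apply: cmeasurable_sum => k; apply: cmeasurableM.
  exact: cmeasurable_cst.
apply: cmeasurableV; apply: cmeasurableD; first exact: cmeasurable_cst.
apply: cmeasurableN; apply: cmeasurableM; last exact: cmeasurable_cst.
by split; [exact: measurable_sqnorm|exact: measurable_cst].
Qed.

Hypothesis a1 : forall k, normc (a k) = 1.

Let na1 k : `|a k| = 1.
Proof. by rewrite norm_normc a1. Qed.

Lemma norm_cplx_lt1 p : disk 1 p -> `|cplx p| < 1.
Proof. by rewrite -unit_disk_disk => p1; rewrite norm_normc ltcR. Qed.

Lemma cauchy_densityE p : disk 1 p ->
  cauchy_density p = mean_density p + fluct_density p.
Proof.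
move=> p1; have := sqr_norm_cauchy na1 (norm_cplx_lt1 p1).
rewrite sqr_norm_cplx norm_normc -rmorphXn /= => E.
have : Re ((cauchy_density p)%:C) = Re (mean_energy a (sqnorm p)%:C + fluctuation a (cplx p)).
  by rewrite -E.
by rewrite raddfD.
Qed.

Lemma fluct_density_avg c (M : nat) (rho : R) p : M.-primitive_root c ->
  normc (cplx p) <= rho -> rho < 1 ->
  `|\sum_(i < M) fluct_density (rotc (c ^+ i) p)| <=
    M%:R * (N%:R ^+ 2 * (rho ^+ M *+ 2 / (1 - rho) ^+ 2)).
Proof.
move=> cP pr r1; have pr' : `|cplx p| <= rho%:C by rewrite norm_normc lecR.
have r1' : rho%:C < 1 :> C by rewrite ltcR.
have := norm_fluct_avg cP na1 pr' r1'.
under eq_bigr do rewrite -cplx_rotc.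
set S := \sum_(i < M) _ => H.
have -> : \sum_(i < M) fluct_density (rotc (c ^+ i) p) = Re S by rewrite raddf_sum.
rewrite -lecR; apply: le_trans (normc_ge_Re S) (le_trans H _).
rewrite le_eqVlt; apply/orP; left; apply/eqP.
by rewrite !(rmorphM, rmorphXn, rmorph_nat, rmorphMn, fmorphV, rmorphB, rmorph1).
Qed.

End Bridge.

(** * The equispaced points as powers of a primitive root *)

Section Roots.
Context {R : realType}.

Lemma cisX (t : R) k : cis t ^+ k = cis (t * k%:R).
Proof.
elim: k => [|k IH]; first by rewrite mulr0 /cis cos0 sin0.
rewrite exprSr IH /cis -natr1 mulrDr mulr1 cosD sinD.
by apply/eqP; rewrite eq_complex /= [cos _ * sin t + _]addrC !eqxx.
Qed.

Lemma normc_cis (t : R) : normc (cis t) = 1.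
Proof. by rewrite /= cos2Dsin2 sqrtr1. Qed.

(** For 0 < i + 1 < N and t = 2 pi (i + 1) / N, cos t = 1 would give sin (t / 2) = 0, although t / 2
    lies strictly between 0 and pi. *)
Lemma prim_root_cis (N : nat) : (0 < N)%N ->
  N.-primitive_root (cis (2 * pi / N%:R : R)).
Proof.
move=> N0; have N0' : (N%:R : R) != 0 by rewrite pnatr_eq0 -lt0n.
rewrite /primitive_root_of_unity N0 /=; apply/forallP => i; rewrite unity_rootE cisX.
apply/eqP; have [->|iN] := eqVneq i.+1 N.
  rewrite divfK // mulrC mulr_natr /cis -[pi *+ 2]add0r (cosD 0) (sinD 0).
  by rewrite cos2pi sin2pi cos0 sin0 !mul0r !mul1r addr0 subr0 eqxx.
apply/negbTE/eqP => -[h _]; move: h.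
set t := (X in cos X); rewrite (splitr t).
rewrite cosD -!expr2 cos2sin2 => h.
have : sin (t / 2) ^+ 2 = 0 by lra.
have iN' : (i.+1 < N)%N by rewrite ltn_neqAle iN ltn_ord.
have t2 : t / 2 = pi * (i.+1%:R / N%:R) by rewrite /t; field.
have : 0 < sin (t / 2).
  apply: sin_gt0_pi; rewrite t2 mulr_gt0 ?pi_gt0 ?divr_gt0 ?ltr0n //=.
  by rewrite gtr_pMr ?pi_gt0 // ltr_pdivrMr ?ltr0n // mul1r ltr_nat.
by move=> s0 /eqP; rewrite sqrf_eq0 gt_eqF.
Qed.

Lemma equispacedE (N : nat) (k : 'I_N) :
  @equispaced R N k = roots_of_unity (cis (2 * pi / N%:R)) k.
Proof. by rewrite /roots_of_unity cisX /equispaced mulrAC. Qed.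

End Roots.

(** * The fluctuation integrates to 0 against radial weights *)

Section RotationAverage.
Context {R : realType}.
Notation C := R[i].
Notation RT := (measurableTypeR R).
Notation AT := (@area_type R).

Lemma bounded_supp_integrable (A : set AT) (f : AT -> R) (K : R) : measurable A ->
  (@area R A < +oo)%E -> measurable_fun A f -> (forall p, A p -> `|f p| <= K) ->
  (@area R).-integrable setT ((EFin \o f) \_ A).
Proof.
move=> mA fA mf fK; apply/(integrable_mkcond _ mA).
apply: measurable_bounded_integrable => //.
exists K; split; first exact: num_real.
by move=> x Kx p Ap; apply: le_trans (fK p Ap) (ltW Kx).
Qed.

Lemma sqnorm_rotc c p : normc c = 1 -> sqnorm (rotc c p) = @sqnorm R p.
Proof. by move=> c1; rewrite /rotc sqnorm_rot //= -sqr_normcE c1 expr1n. Qed.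

Lemma measurable_fun_area_rotc (c : C) : normc c = 1 ->
  measurable_fun [set: AT] (rotc c : AT -> AT).
Proof. by move=> c1; apply: measurable_fun_area_rot; rewrite /= -sqr_normcE c1 expr1n. Qed.

Variable W : AT -> R.
Hypothesis mW : measurable_fun (disk 1 : set AT) W.
Hypothesis W0 : forall p, disk 1 p -> 0 <= W p.
Hypothesis W_rot : forall c p, normc c = 1 -> W (rotc c p) = W p.

Definition radius n : R := 1 - n.+1%:R^-1.
(** A rotation invariant exhaustion of the disk. On each set |z| stays away from 1, which bounds the
    fluctuation, and the weight is bounded, so that all integrals converge. *)
Definition cut n : set AT := [set p | sqnorm p <= radius n ^+ 2 /\ W p <= n%:R].

Lemma radius_ge0 n : 0 <= radius n.
Proof. by rewrite subr_ge0 invf_le1 // ler1n. Qed.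

Lemma radius_lt1 n : radius n < 1.
Proof. by rewrite ltrBlDr ltrDl invr_gt0. Qed.

Lemma cut_disk n : cut n `<=` disk 1.
Proof.
move=> p [pr _]; apply: le_lt_trans pr _.
by rewrite expr_lt1 ?radius_lt1 ?radius_ge0.
Qed.

Lemma measurable_area_disk s : measurable (disk s : set AT).
Proof. by apply: borel_area_measurable; exact: measurable_disk. Qed.

Lemma measurable_cut n : measurable (cut n).
Proof.
have -> : cut n = (sqnorm @^-1` `]-oo, radius n ^+ 2]) `&` (disk 1 `&` W @^-1` `]-oo, n%:R]).
  apply/seteqP; split => p /=; rewrite !in_itv /=.
    by move=> h; have := cut_disk h; case: h.
  by move=> [h [_ h']].
apply: measurableI; last by apply: mW; [exact: measurable_area_disk|exact: measurable_itv].
by apply: borel_area_measurable; apply: (measurable_preimage measurable_sqnorm); exact: measurable_itv.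
Qed.

Lemma cut_rotc c n p : normc c = 1 -> cut n (rotc c p) = cut n p.
Proof. by move=> c1; rewrite /cut /= sqnorm_rotc // W_rot. Qed.

Lemma area_disk1 : @area R (disk 1) = (@disk_area R)%:E.
Proof. by rewrite area_borel ?mu2_disk1 //; exact: measurable_disk. Qed.

Lemma area_cut_lty n : (@area R (cut n) < +oo)%E.
Proof.
apply: (@le_lt_trans _ _ (@area R (disk 1))); last by rewrite area_disk1 ltry.
by apply: le_measure; rewrite ?inE; [exact: measurable_cut|exact: measurable_area_disk|exact: cut_disk].
Qed.

Lemma cut_nondecreasing : nondecreasing_seq cut.
Proof.
move=> m n mn; apply/subsetPset => p [h1 h2]; split.
  apply: le_trans h1 _; rewrite lerXn2r ?nnegrE ?radius_ge0 // lerD2l lerN2.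
  by rewrite lef_pV2 ?posrE // ler_nat ltnS.
by apply: le_trans h2 _; rewrite ler_nat.
Qed.

Lemma bigcup_cut : \bigcup_n cut n = disk 1.
Proof.
apply/seteqP; split => [p [n _]|p p1]; first exact: cut_disk.
have s1 : Num.sqrt (sqnorm p) < 1 by rewrite -(sqrtr1 R) ltr_sqrt.
have s0 : 0 <= sqnorm p by rewrite addr_ge0 // sqr_ge0.
pose d := 1 - Num.sqrt (sqnorm p); have d0 : 0 < d by rewrite subr_gt0.
have Wp := W0 p1; have di0 : 0 <= d^-1 by rewrite invr_ge0 ltW.
(* This n is at least W p and n + 1 is at least 1/d; the latter says that |z| <= [radius n]. *)
pose n := (Num.truncn (W p) + Num.truncn d^-1).+1.
have h1 : W p <= n%:R.
  apply/ltW/(lt_le_trans (truncnS_gt _)); rewrite ler_nat ltnS leq_addr //.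
have h2 : d^-1 <= n.+1%:R.
  apply/ltW/(lt_le_trans (truncnS_gt _)); rewrite ler_nat ltnS.
  by apply: leq_trans (leq_addl (Num.truncn (W p)) _) _.
exists n => //; split=> //; rewrite -(sqr_sqrtr s0) lerXn2r ?nnegrE ?sqrtr_ge0 ?radius_ge0 //.
rewrite /radius lerBrDr -lerBrDl -[leRHS]invrK lef_pV2 ?posrE ?invr_gt0 //.
Qed.

Variables (N : nat) (a : 'I_N -> C).
Hypothesis a1 : forall k, normc (a k) = 1.

Let excess (p : AT) : R := fluct_density a p * W p.

Lemma measurable_fluct_density : measurable_fun [set: AT] (cauchy_density a \- mean_density a).
Proof.
apply: measurable_fun_area => //; apply: measurable_funB.
  exact: measurable_cauchy_density.
exact: measurable_mean_density.
Qed.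

Lemma measurable_excess n : measurable_fun (cut n) excess.
Proof.
apply: measurable_funM; last first.
  by apply: measurable_funS mW; [exact: measurable_area_disk|exact: cut_disk].
(* On the disk the fluctuation is a difference of two functions already known to be measurable. *)
have E : {in cut n, cauchy_density a \- mean_density a =1 fluct_density a}.
  by move=> p /set_mem /cut_disk p1 /=; rewrite (cauchy_densityE a1 p1) addrAC subrr add0r.
have H : measurable_fun (cut n) (cauchy_density a \- mean_density a).
  exact: measurable_funTS measurable_fluct_density.
exact: (eq_measurable_fun _ E H).
Qed.

Lemma normc_cut n p : cut n p -> normc (cplx p) <= radius n.
Proof.
move=> [h _]; rewrite -(ler_pXn2r (n := 2)) ?nnegrE ?radius_ge0 ?sqr_normc_cplx //.
by rewrite /normc; case: cplx => *; exact: sqrtr_ge0.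
Qed.

Definition fluct_const n : R := N%:R ^+ 2 * (2 / (1 - radius n) ^+ 2).

Lemma fluct_const_ge0 n : 0 <= fluct_const n.
Proof.
rewrite /fluct_const mulr_ge0 ?exprn_ge0 // divr_ge0 // exprn_ge0 //.
by rewrite subr_ge0 ltW // radius_lt1.
Qed.

Lemma fluct_avg_cut n (c : C) (M : nat) p : M.-primitive_root c -> cut n p ->
  `|\sum_(i < M) fluct_density a (rotc (c ^+ i) p)| <= M%:R * (fluct_const n * radius n ^+ M).
Proof.
move=> cP pn; apply: le_trans (fluct_density_avg a1 cP (normc_cut pn) (radius_lt1 n)) _.
rewrite le_eqVlt; apply/orP; left; apply/eqP; rewrite /fluct_const; ring.
Qed.

Lemma excess_bound n p : cut n p -> `|excess p| <= fluct_const n * radius n * n%:R.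
Proof.
move=> pn; have p1 := cut_disk pn; rewrite /excess normrM; apply: ler_pM => //; last first.
  by rewrite ger0_norm ?W0 //; case: pn.
(* For M = 1 the only rotation is the identity, and the averaged bound becomes a pointwise one. *)
have := fluct_avg_cut (prim_root_cis (isT : (0 < 1)%N)) pn.
rewrite big_ord1 expr0 expr1 mul1r.
by have -> : rotc 1 p = p by case: (p) => x y; rewrite /rotc /rot /= !mul1r !mul0r subr0 add0r.
Qed.

Lemma integrable_excess n : (@area R).-integrable setT ((EFin \o excess) \_ (cut n)).
Proof.
apply: (bounded_supp_integrable (K := fluct_const n * radius n * n%:R)).
- exact: measurable_cut.
- exact: area_cut_lty.
- exact: measurable_excess.
- by move=> p; exact: excess_bound.
Qed.

Lemma excess_rotc c n p : normc c = 1 ->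
  ((EFin \o excess) \_ (cut n)) (rotc c p) =
  ((fun q => (fluct_density a (rotc c q) * W q)%:E) \_ (cut n)) p.
Proof.
move=> c1; rewrite !patchE.
have -> : (rotc c p \in cut n) = (p \in cut n).
  by apply/idP/idP => /set_mem h; apply/mem_set; move: h; rewrite cut_rotc.
by case: ifP => // _; rewrite /= /excess W_rot.
Qed.

Lemma integrable_excess_rotc c n : normc c = 1 ->
  (@area R).-integrable setT (((EFin \o excess) \_ (cut n)) \o rotc c).
Proof.
move=> c1.
have mf : measurable_fun setT ((EFin \o excess) \_ (cut n)).
  by have /integrableP[] := integrable_excess n.
rewrite (_ : _ \o _ = (EFin \o (fun p => excess (rotc c p))) \_ (cut n)); last first.
  apply/funext => p; rewrite /= excess_rotc // !patchE; case: ifP => // _.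
  by rewrite /= /excess W_rot.
apply: (bounded_supp_integrable (K := fluct_const n * radius n * n%:R)).
- exact: measurable_cut.
- exact: area_cut_lty.
- apply: (measurable_comp (F := cut n)).
  + exact: measurable_cut.
  + by move=> _ [p pn <-]; rewrite cut_rotc.
  + exact: measurable_excess.
  + by apply: measurable_funTS; exact: measurable_fun_area_rotc.
- by move=> p pn; apply: excess_bound; rewrite cut_rotc.
Qed.

(** Let v be the integral. By rotation invariance M v is the integral of the sum of M rotated
    copies, which is at most M times a constant times r^M with r = [radius n] < 1. Hence |v| <= k
    r^M for every M >= 1, and M tends to infinity. *)
Lemma integral_excess n : (\int[@area R]_(p in cut n) (excess p)%:E = 0)%E.
Proof.
rewrite integral_mkcond; set G := (_ \_ (cut n)).
have iG : (@area R).-integrable setT G by exact: integrable_excess.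
have := integrable_fin_num measurableT iG.
case E : (\int[_]_x G x)%E => [v| |] // _; congr (_%:E).
have key M : `|v| <= (fluct_const n * n%:R * fine (@area R (cut n))) * radius n ^+ M.+1.
  have cP := prim_root_cis (isT : (0 < M.+1)%N) (R := R); set c := cis _ in cP.
  have c1 i : normc (c ^+ i) = 1 by rewrite cisX normc_cis.
  pose rc i : AT -> AT := rotc (c ^+ i).
  have iGi i : (@area R).-integrable setT (G \o rc i).
    exact: integrable_excess_rotc.
  have Ei i : (\int[@area R]_p (G \o rc i) p = v%:E)%E.
    rewrite -E; apply: integral_rot => //; last exact: iGi.
    by rewrite /= -sqr_normcE c1 expr1n.
  have ES : (\int[@area R]_p (\sum_(i < M.+1) (G \o rc i) p) = (M.+1%:R * v)%:E)%E.
    rewrite integral_sum //.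
    under eq_bigr do rewrite Ei.
    by rewrite sumEFin sumr_const card_ord mulr_natl.
  have : (`|(M.+1%:R * v)%:E| <=
     (M.+1%:R * (fluct_const n * radius n ^+ M.+1) * n%:R)%:E * @area R (cut n))%E.
    rewrite -ES.
    have -> : (\int[@area R]_p (\sum_(i < M.+1) (G \o rc i) p) =
       \int[@area R]_(p in cut n) (\sum_(i < M.+1) (G \o rc i) p))%E.
      rewrite [RHS]integral_mkcond; apply: eq_integral => p _; rewrite patchE.
      case: ifPn => // pn; rewrite big1 // => i _.
      by rewrite /= /G /rc excess_rotc // patchE (negPf pn).
    have mS : measurable_fun setT (fun p => \sum_(i < M.+1) (G \o rc i) p)%E.
      apply: emeasurable_sum => i; by have /integrableP[] := iGi i.
    apply: le_trans (le_abse_integral _ (measurable_cut n) (measurable_funTS mS)) _.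
    apply: integral_le_bound; first exact: measurable_cut.
    - exact: measurable_funTS.
    - rewrite lee_fin; apply: mulr_ge0 => //; apply: mulr_ge0 => //.
      by apply: mulr_ge0; [exact: fluct_const_ge0|apply: exprn_ge0; exact: radius_ge0].
    - apply/aeW => p pn.
      under eq_bigr => i _ do rewrite /= /G /rc excess_rotc // patchE mem_set //.
      rewrite sumEFin -mulr_suml /= lee_fin normrM; apply: ler_pM => //.
        exact: fluct_avg_cut.
      by rewrite ger0_norm; [case: pn|exact: W0 (cut_disk pn)].
  rewrite -[@area R (cut n)]fineK; last by rewrite ge0_fin_numE ?measure_ge0 // area_cut_lty.
  rewrite -EFinM lee_fin normrM normr_nat -!mulrA ler_pM2l ?ltr0n // => h.
  by apply: le_trans h _; rewrite le_eqVlt; apply/orP; left; apply/eqP; ring.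
have /normr0_eq0 : `|v| = 0.
  apply/eqP; rewrite eq_le normr_ge0 andbT.
  set k := _ * _ in key; rewrite -[leRHS](mulr0 k).
  apply: (@ler_cvg_to _ \oo _ _ (fun=> `|v|) (fun M => k * radius n ^+ M.+1)).
  - exact: cvg_cst.
  - apply: cvgMr; rewrite (cvg_shiftS (fun M => radius n ^+ M)).
    by apply: cvg_expr; rewrite ger0_norm ?radius_ge0 ?radius_lt1.
  - by apply: nearW.
by [].
Qed.

End RotationAverage.

(** * Pointwise comparison of circular means *)

Section MeanDensity.
Context {R : realType}.
Notation C := R[i].
Notation RT := (measurableTypeR R).
Notation AT := (@area_type R).
Variables (N : nat) (a : 'I_N -> C).
Hypothesis a1 : forall k, normc (a k) = 1.
Implicit Types p : RT * RT.

Let na1 k : `|a k| = 1.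
Proof. by rewrite norm_normc a1. Qed.

Lemma sqnorm_ge0 p : 0 <= sqnorm p.
Proof. by rewrite addr_ge0 // sqr_ge0. Qed.

Lemma sqnorm_range p : disk 1 p -> 0 <= (sqnorm p)%:C < 1.
Proof. by move=> p1; rewrite ler0c sqnorm_ge0 ltcR. Qed.

Lemma mean_density_bound p : disk 1 p -> `|mean_density a p| <= N%:R ^+ 2 / depth p.
Proof.
move=> p1; rewrite -lecR; apply: le_trans (normc_ge_Re _) _.
apply: le_trans (norm_mean_energy na1 (sqnorm_range p1)) _.
rewrite le_eqVlt; apply/orP; left; apply/eqP.
by rewrite !(rmorphM, rmorphXn, rmorph_nat, fmorphV, rmorphB, rmorph1).
Qed.

Hypothesis N0 : (0 < N)%N.

Let eP : N.-primitive_root (cis (2 * pi / N%:R : R)) := prim_root_cis N0.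

Lemma mean_density_min p : disk 1 p -> mean_density (@equispaced R N) p <= mean_density a p.
Proof.
move=> p1; have -> : @equispaced R N = roots_of_unity (cis (2 * pi / N%:R)).
  by apply/funext => k; exact: equispacedE.
have /andP[s0 s1] := sqnorm_range p1.
suff : mean_energy (roots_of_unity (N := N) (cis (2 * pi / N%:R))) (sqnorm p)%:C <=
    mean_energy a (sqnorm p)%:C.
  by rewrite lecE => /andP[].
move: s0; rewrite le_eqVlt => /orP[/eqP <-|s0]; first exact: mean_energy_min0.
by apply: mean_energy_min => //; rewrite s0.
Qed.

(** Equality on a single circle of positive radius is enough. Since [mean_energy] is real, equality
    of the real parts is equality of the complex numbers. *)
Lemma mean_density_min_eq p : disk 1 p -> 0 < sqnorm p ->
  mean_density a p = mean_density (@equispaced R N) p ->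
  exists c : C, normc c = 1 /\ exists s : 'S_N, forall k, a k = c * @equispaced R N (s k).
Proof.
move=> p1 p0; have E : @equispaced R N = roots_of_unity (cis (2 * pi / N%:R)).
  by apply/funext => k; exact: equispacedE.
rewrite E => em; have /andP[s0 s1] := sqnorm_range p1.
have xr : (sqnorm p)%:C \is Num.real by rewrite ger0_real.
have reE (b : 'I_N -> C) : mean_energy b (sqnorm p)%:C = (mean_density b p)%:C.
  rewrite /mean_density; have /CrealP/complex_realP[k ->] // := conj_mean_energy b xr.
have [||c [c1 H]] := mean_energy_min_eq eP na1 (x := (sqnorm p)%:C).
- by rewrite s1 andbT ltcR.
- by rewrite !reE em.
by exists c; split => //; move: c1; rewrite norm_normc => /complexI.
Qed.

End MeanDensity.

(** A region of positive area away from the centre, where the equality case looks for a point. *)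
Lemma area_annulus {R : realType} :
  @area R (disk 1 `\` disk 2^-1) = (@disk_area R * 2^-1)%:E.
Proof.
have -> : disk 1 `\` disk 2^-1 = @depth R @^-1` `]0, 2^-1].
  apply/seteqP; split => p; rewrite /disk /depth /= in_itv /= subr_gt0.
    by move=> [-> /negP]; rewrite -leNgt [1 - _ <= _]lerBlDr -lerBlDl [1 - _](_ : _ = 2^-1) //; field.
  move=> /andP[-> p2]; split => //; apply/negP; rewrite -leNgt; move: p2.
  by rewrite [1 - _ <= _]lerBlDr -lerBlDl [1 - _](_ : _ = 2^-1) //; field.
rewrite area_borel; last by apply: (measurable_preimage measurable_depth); exact: measurable_itv.
rewrite image_depth; [|exact: measurable_itv|].
  by rewrite lebesgue_measure_itv /= lte_fin invr_gt0 ltr0n -EFinB subr0.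
move=> x /=; rewrite !in_itv /= => /andP[_ h]; apply: le_trans h _.
by rewrite invf_le1 // ler1n.
Qed.

(** * Weighted integrals *)

Section WeightedIntegral.
Context {R : realType}.
Notation C := R[i].
Notation RT := (measurableTypeR R).
Notation AT := (@area_type R).
Variable W : AT -> R.
Hypothesis mW : measurable_fun (disk 1 : set AT) W.
Hypothesis W0 : forall p, disk 1 p -> 0 <= W p.
Hypothesis W_rot : forall c p, normc c = 1 -> W (rotc c p) = W p.
Variables (N : nat).
Hypothesis N0 : (0 < N)%N.
Notation eqsp := (@equispaced R N).
Implicit Types (a : 'I_N -> C).

Let eq1 k : normc (eqsp k) = 1.
Proof. exact: normc_cis. Qed.

Lemma measurable_meanW a : measurable_fun (disk 1 : set AT) (fun p => mean_density a p * W p).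
Proof.
apply: measurable_funM => //; apply: measurable_funTS; apply: measurable_fun_area => //.
exact: measurable_mean_density.
Qed.

Lemma measurable_cauchyW a : measurable_fun (disk 1 : set AT) (fun p => cauchy_density a p * W p).
Proof.
apply: measurable_funM => //; apply: measurable_funTS; apply: measurable_fun_area => //.
exact: measurable_cauchy_density.
Qed.

Lemma cauchyW_ge0 a p : disk 1 p -> (0 <= (cauchy_density a p * W p)%:E)%E.
Proof.
move=> p1; rewrite lee_fin mulr_ge0 ?W0 // exprn_ge0 // /normc.
by case: cauchy_sum => *; exact: sqrtr_ge0.
Qed.

Lemma integrable_meanW a n : (forall k, normc (a k) = 1) ->
  (@area R).-integrable (cut W n) (EFin \o (fun p => mean_density a p * W p)).
Proof.
move=> a1; apply: measurable_bounded_integrable.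
- exact: measurable_cut.
- exact: area_cut_lty.
- by apply: measurable_funS (measurable_meanW a); [exact: measurable_area_disk|exact: cut_disk].
exists (N%:R ^+ 2 / (1 - radius n ^+ 2) * n%:R); split; first exact: num_real.
move=> K hK p pn; apply: le_trans (ltW hK); have p1 := cut_disk pn.
rewrite normrM; apply: ler_pM => //; last by rewrite ger0_norm ?W0 //; case: pn.
apply: le_trans (mean_density_bound a1 p1) _; rewrite ler_wpM2l ?exprn_ge0 //.
have r2 : 0 < 1 - radius n ^+ 2 :> R by rewrite subr_gt0 expr_lt1 ?radius_lt1 ?radius_ge0.
have h : 1 - radius n ^+ 2 <= depth p by rewrite lerD2l lerN2; case: pn.
by rewrite lef_pV2 ?posrE // (lt_le_trans r2).
Qed.

Lemma integral_cut a n : (forall k, normc (a k) = 1) ->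
  (\int[@area R]_(p in cut W n) (cauchy_density a p * W p)%:E =
   \int[@area R]_(p in cut W n) (mean_density a p * W p)%:E)%E.
Proof.
move=> a1; have mc := measurable_cut mW n.
have im := integrable_meanW n a1.
have ie : (@area R).-integrable (cut W n) (EFin \o (fun p => fluct_density a p * W p)).
  exact/(integrable_mkcond _ mc)/integrable_excess.
rewrite -[RHS]adde0 -(integral_excess mW W0 W_rot a1 n).
rewrite -(integralD_EFin mc im ie); apply: eq_integral => p /set_mem /cut_disk p1.
by rewrite /= -EFinD -mulrDl -cauchy_densityE.
Qed.

Lemma cvg_cut a : (\int[@area R]_(p in cut W n) (cauchy_density a p * W p)%:E @[n --> \oo] -->
  \int[@area R]_(p in disk 1) (cauchy_density a p * W p)%:E)%E.
Proof.
rewrite -(bigcup_cut W0); apply: ge0_nondecreasing_set_cvg_integral.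
- exact: cut_nondecreasing.
- by move=> n; exact: measurable_cut.
- move=> n; apply/measurable_EFinP.
  by apply: measurable_funS (measurable_cauchyW a); [exact: measurable_area_disk|exact: cut_disk].
- by move=> n p /cut_disk p1; exact: cauchyW_ge0.
Qed.

(** On each cut |f|^2 may be replaced by its circular mean, and the means compare pointwise. The
    limit n to infinity is taken in the extended reals, so infinite integrals are covered. *)
Lemma weighted_integral_min a : (forall k, normc (a k) = 1) ->
  (\int[@area R]_(p in disk 1) (cauchy_density eqsp p * W p)%:E <=
   \int[@area R]_(p in disk 1) (cauchy_density a p * W p)%:E)%E.
Proof.
move=> a1; apply: (lee_cvg_to (@cvg_cut eqsp) (@cvg_cut a)); apply: nearW => n.
rewrite !integral_cut //; apply: le_integral.
- exact: measurable_cut.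
- exact: integrable_meanW.
- exact: integrable_meanW.
move=> p /set_mem /cut_disk p1; rewrite lee_fin ler_wpM2r ?W0 //.
exact: mean_density_min.
Qed.

Hypothesis W_gt0 : forall p, disk 1 p -> 0 < W p.
Hypothesis W_fin : (\int[@area R]_(p in disk 1) (W p / depth p)%:E < +oo)%E.

Lemma depth_gt0 p : disk 1 p -> 0 < depth p :> R.
Proof. by rewrite subr_gt0. Qed.

Lemma measurable_Wdepth : measurable_fun (disk 1 : set AT) (fun p => W p / depth p).
Proof.
have H : measurable_fun (disk 1) (fun p : RT * RT => (depth p : R) `^ (-1)).
  apply: measurable_funTS; apply: (measurableT_comp (measurable_powR (-1))).
  exact: measurable_depth.
have {}H := measurable_fun_area (measurable_disk 1) H.
have E : {in (disk 1 : set AT), (fun p => (depth p : R) `^ (-1)) =1 (fun p => (depth p)^-1)}.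
  by move=> p /set_mem p1; rewrite /= powR_inv1 // ltW // depth_gt0.
exact: measurable_funM mW (eq_measurable_fun _ E H).
Qed.

Lemma Wdepth_ge0 p : disk 1 p -> (0 <= (W p / depth p)%:E)%E.
Proof. by move=> p1; rewrite lee_fin divr_ge0 ?W0 // ltW // depth_gt0. Qed.

(** On a cut |f|^2 integrates like its circular mean, which is at most N^2 / (1 - |z|^2). The
    integral of [W p / depth p] therefore bounds all cuts uniformly. *)
Lemma weighted_integral_fin a : (forall k, normc (a k) = 1) ->
  (\int[@area R]_(p in disk 1) (cauchy_density a p * W p)%:E < +oo)%E.
Proof.
move=> a1; set B := ((N%:R ^+ 2)%:E * \int[@area R]_(p in disk 1) (W p / depth p)%:E)%E.
apply: (@le_lt_trans _ _ B); last by rewrite lte_mul_pinfty // lee_fin exprn_ge0.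
apply: (lee_cvg_to (@cvg_cut a) (cvg_cst B)); apply: nearW => n.
have <- : (\int[@area R]_(p in disk 1) ((N%:R ^+ 2)%:E * (W p / depth p)%:E) = B)%E.
  apply: ge0_integralZl_EFin; last exact: exprn_ge0.
  - exact: measurable_area_disk.
  - by move=> p; exact: Wdepth_ge0.
  - exact/measurable_EFinP/measurable_Wdepth.
rewrite integral_cut //.
have mc := measurable_cut mW n; have mD := @measurable_area_disk R 1.
have mf : measurable_fun (disk 1 : set AT) (fun p => ((N%:R ^+ 2)%:E * (W p / depth p)%:E)%E).
  by apply: measurable_funeM; exact/measurable_EFinP/measurable_Wdepth.
have f0 p : disk 1 p -> (0 <= (N%:R ^+ 2)%:E * (W p / depth p)%:E)%E.
  by move=> p1; rewrite mule_ge0 ?lee_fin ?exprn_ge0 // divr_ge0 ?W0 // ltW // depth_gt0.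
apply: (@le_trans _ _ (\int[@area R]_(p in cut W n) ((N%:R ^+ 2)%:E * (W p / depth p)%:E))%E); last first.
  by apply: ge0_subset_integral => //; exact: cut_disk.
apply: (@le_trans _ _ (\int[@area R]_(p in cut W n) `|(mean_density a p * W p)%:E|)%E).
  have mm : measurable_fun (cut W n) (fun p => (mean_density a p * W p)%:E).
    by have /integrableP[] := integrable_meanW n a1.
  exact: le_trans (lee_abs _) (le_abse_integral _ mc mm).
have mm : measurable_fun (cut W n) (fun p => `|(mean_density a p * W p)%:E|%E).
  have /integrableP[h _] := integrable_meanW n a1.
  move: h => /measurable_EFinP h.
  have H : measurable_fun (cut W n) (fun p => `|mean_density a p * W p|).
    exact: measurableT_comp (@normr_measurable R setT) h.
  exact/measurable_EFinP/H.
have mf' : measurable_fun (cut W n) (fun p => ((N%:R ^+ 2)%:E * (W p / depth p)%:E)%E).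
  exact: measurable_funS mD (@cut_disk _ W n) mf.
refine (@ge0_le_integral _ _ _ (@area R) _ mc _ _ _ mm mf' _) => [p _|p /cut_disk p1]; first exact: abse_ge0.
rewrite lee_fin normrM (ger0_norm (W0 p1)) [W p / _]mulrC mulrA.
by rewrite ler_wpM2r ?W0 //; exact: mean_density_bound.
Qed.

(** The two integrals differ by that of d, the nonnegative difference of the circular means times W.
    Both being equal and finite, d vanishes almost everywhere. If a were not a rotated copy of the
    roots of unity, d would be nonzero on a whole annulus of positive area. *)
Lemma weighted_integral_min_eq a : (forall k, normc (a k) = 1) ->
  (\int[@area R]_(p in disk 1) (cauchy_density a p * W p)%:E =
   \int[@area R]_(p in disk 1) (cauchy_density eqsp p * W p)%:E)%E ->
  exists c : C, normc c = 1 /\ exists s : 'S_N, forall k, a k = c * eqsp (s k).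
Proof.
move=> a1 E; apply: contrapT => H.
have mD := @measurable_area_disk R 1.
pose d p := (mean_density a p - mean_density eqsp p) * W p.
have d0 p : disk 1 p -> (0 <= (d p)%:E)%E.
  move=> p1; rewrite lee_fin mulr_ge0 ?W0 // subr_ge0; exact: mean_density_min.
have md : measurable_fun (disk 1 : set AT) (EFin \o d).
  apply/measurable_EFinP.
  rewrite (_ : d = (fun p => mean_density a p * W p) \- (fun p => mean_density eqsp p * W p)).
    by apply: measurable_funB; exact: measurable_meanW.
  by apply/funext => p; rewrite /d mulrBl.
have dc : (\int[@area R]_(p in cut W n) (d p)%:E @[n --> \oo] -->
    \int[@area R]_(p in disk 1) (d p)%:E)%E.
  rewrite -(bigcup_cut W0); apply: ge0_nondecreasing_set_cvg_integral.
  - exact: cut_nondecreasing.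
  - by move=> n; exact: measurable_cut.
  - by move=> n; apply: measurable_funS md => //; exact: cut_disk.
  - by move=> n p /cut_disk; exact: d0.
have I0 (b : 'I_N -> C) : (0 <= \int[@area R]_(p in disk 1) (cauchy_density b p * W p)%:E)%E.
  by apply: integral_ge0 => p p1; exact: cauchyW_ge0.
have Ieq : (\int[@area R]_(p in disk 1) (cauchy_density a p * W p)%:E =
   \int[@area R]_(p in disk 1) (cauchy_density eqsp p * W p)%:E +
   \int[@area R]_(p in disk 1) (d p)%:E)%E.
  (* Additivity is used on the cuts, where the means are integrable, and passed to the limit. *)
  have cD : (\int[@area R]_(p in cut W n) (cauchy_density eqsp p * W p)%:E
     + \int[@area R]_(p in cut W n) (d p)%:E @[n --> \oo] -->
     \int[@area R]_(p in disk 1) (cauchy_density eqsp p * W p)%:E +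
     \int[@area R]_(p in disk 1) (d p)%:E)%E.
    apply: (cvgeD _ (@cvg_cut eqsp) dc); apply: ge0_adde_def; rewrite inE //.
    exact: integral_ge0.
  have ca := @cvg_cut a; apply: (cvg_unique _ ca); first exact: ereal_hausdorff.
  rewrite (_ : (fun n => _) = (fun n => \int[@area R]_(p in cut W n) (cauchy_density eqsp p * W p)%:E
     + \int[@area R]_(p in cut W n) (d p)%:E)%E) //.
  apply/funext => n; rewrite !integral_cut //.
  have mc := measurable_cut mW n.
  have id : (@area R).-integrable (cut W n) (EFin \o d).
    rewrite (_ : EFin \o d =
      ((EFin \o (fun p => (mean_density a p * W p)%R)) \-
       (EFin \o (fun p => (mean_density eqsp p * W p)%R)))%E).
      by apply: integrableB => //; exact: integrable_meanW.
    by apply/funext => p; rewrite /= -EFinB /d mulrBl.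
  rewrite -(integralD_EFin mc (integrable_meanW n eq1) id).
  by apply: eq_integral => p _; rewrite /= -EFinD -mulrDl addrC subrK.
have Id0 : (\int[@area R]_(p in disk 1) (d p)%:E = 0)%E.
  have fin : (\int[@area R]_(p in disk 1) (cauchy_density eqsp p * W p)%:E \is a fin_num)%E.
    by rewrite ge0_fin_numE ?I0 // weighted_integral_fin.
  by rewrite -[LHS](addeK _ fin) [X in (X - _)%E]addeC -Ieq E subee.
have : (\int[@area R]_(p in disk 1) `|(d p)%:E| = 0)%E.
  rewrite -Id0; apply: eq_integral => p /set_mem p1; rewrite gee0_abs //; exact: d0.
move/(ae_eq_integral_abs (@area R) mD md) => -[B [mB B0 hB]].
have kpos := @disk_area_gt0 R.
have sub : disk 1 `\` disk 2^-1 `<=` B.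
  move=> p [p1 /negP]; rewrite -leNgt => p2; apply: hB => /= h.
  have sp : 0 < sqnorm p by apply: lt_le_trans p2; rewrite invr_gt0.
  have := h p1; rewrite /d => -[] /eqP; rewrite mulf_eq0 (gt_eqF (W_gt0 p1)) orbF subr_eq0 => /eqP e.
  by apply: H; exact: (mean_density_min_eq a1 N0 p1 sp e).
have : (@area R (disk 1 `\` disk 2^-1) <= 0)%E.
  rewrite -B0; apply: le_measure; rewrite ?inE //.
  by apply: measurableD => //; exact: measurable_area_disk.
rewrite area_annulus lee_fin leNgt mulr_gt0 ?invr_gt0 //.
Qed.
End WeightedIntegral.

(** * Power weights *)

Section PowerWeight.
Context {R : realType}.
Notation mu := (@lebesgue_measure R).
Notation RT := (measurableTypeR R).
Notation AT := (@area_type R).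
Variable alpha : R.
Hypothesis alpha0 : 0 < alpha.

(** The interval stays away from 0, where the integrand blows up if alpha < 1. *)
Lemma powR_FTC (e : R) : 0 < e < 1 ->
  (\int[mu]_(t in `[e, 1%R]) (alpha * t `^ (alpha - 1))%:E = (1 - e `^ alpha)%:E)%E.
Proof.
move=> /andP[e0 e1].
have pos x : x \in `[e, 1] -> 0 < x.
  by rewrite in_itv /= => /andP[ex _]; exact: lt_le_trans ex.
have dp (b x : R) : 0 < x -> derivable ((@powR R) ^~ b) x 1.
  by move=> x0; apply: derivable_powR; rewrite in_itv /= x0.
have cp (b x : R) : 0 < x -> (t `^ b @[t --> x] --> x `^ b).
  by move=> x0; have /derivable1_diffP/differentiable_continuous := dp b x x0.
rewrite (@continuous_FTC2 R _ ((@powR R) ^~ alpha)) //.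
- by rewrite powR1 EFinB.
- apply: continuous_in_subspaceT => x /set_mem /= /pos x0.
  by apply: cvgMr; exact: cp.
- split.
  + by move=> x /subset_itv_oo_cc /pos; exact: dp.
  + by apply: cvg_at_right_filter; exact: cp.
  + by apply: cvg_at_left_filter; exact: cp.
- move=> x /subset_itv_oo_cc /pos x0; apply: powR_derive1.
  by rewrite in_itv /= x0.
Qed.

Lemma powR_integral_le1 :
  (\int[mu]_(t in `]0%R, 1%R]) (alpha * t `^ (alpha - 1))%:E <= 1)%E.
Proof.
have mf : measurable_fun [set: R] (fun t => (alpha * t `^ (alpha - 1))%:E).
  apply/measurable_EFinP; apply: measurable_funM => //; exact: measurable_powR.
(* The offset 2 keeps the left endpoint strictly below 1, as [powR_FTC] requires. *)
pose F n : set R := `[n.+2%:R^-1, 1]%classic.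
have F01 : \bigcup_n F n = `]0%R, 1%R]%classic.
  apply/seteqP; split => t.
    move=> [n _]; rewrite /F /= !in_itv /= => /andP[nt ->]; rewrite andbT.
    by apply: lt_le_trans nt; rewrite invr_gt0.
  rewrite /= in_itv /= => /andP[t0 t1]; exists (Num.truncn t^-1) => //.
  rewrite /F /= in_itv /= t1 andbT.
  rewrite -[leRHS]invrK lef_pV2 ?posrE ?invr_gt0 //.
  apply/ltW/(lt_le_trans (truncnS_gt _)); by rewrite ler_nat ltnW.
have c : (\int[mu]_(t in F n) (alpha * t `^ (alpha - 1))%:E @[n --> \oo] -->
    \int[mu]_(t in \bigcup_n F n) (alpha * t `^ (alpha - 1))%:E)%E.
  apply: ge0_nondecreasing_set_cvg_integral.
  - move=> m n mn; apply/subsetPset => t; rewrite /F /= !in_itv /= => /andP[h ->].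
    rewrite andbT; apply: le_trans h; by rewrite lef_pV2 ?posrE // ler_nat !ltnS.
  - by move=> n; exact: measurable_itv.
  - by move=> n; exact: measurable_funTS.
  - by move=> n t _; rewrite lee_fin mulr_ge0 ?powR_ge0 // ltW.
rewrite -F01; apply: (lee_cvg_to c (cvg_cst 1%E)); apply: nearW => n.
rewrite powR_FTC ?lee_fin ?gerBl ?powR_ge0 //.
by rewrite invr_gt0 ltr0n /= invf_lt1 // ltr1n.
Qed.

Lemma measurable_fun_depth_area : measurable_fun (U := RT) [set: AT] (@depth R).
Proof. by apply: measurable_fun_area => //; exact: measurable_depth. Qed.

(** By [image_depth] the integral over the disk is [disk_area] times the integral of t^(alpha - 1)
    over ]0, 1], and the latter is at most 1 / alpha. *)
Lemma power_weight_fin :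
  (\int[@area R]_(p in disk 1) (power_weight alpha (depth p) / depth p)%:E < +oo)%E.
Proof.
pose f (t : RT) : \bar R := (power_weight alpha t / t)%:E.
pose I01 : set RT := `]0%R, 1%R]%classic.
have mI : measurable I01 by exact: measurable_itv.
have pE (t : R) : 0 < t -> t `^ (alpha - 1) = t `^ alpha / t.
  by move=> t0; rewrite powRB ?powRr1 ?(ltW t0) ?(gt_eqF t0) ?implybT.
have fE (t : R) : 0 < t -> (alpha%:E * f t = (alpha * t `^ (alpha - 1))%:E)%E.
  by move=> t0; rewrite /f /power_weight -EFinM pE.
have mf : measurable_fun I01 f.
  have H : measurable_fun I01 (fun t : R => (t `^ (alpha - 1))%:E).
    by apply: measurable_funTS; apply/measurable_EFinP; exact: measurable_powR.
  apply: eq_measurable_fun H => t /set_mem; rewrite /I01 /= in_itv /= => /andP[t0 _].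
  by rewrite /f /power_weight pE.
have f0 t : I01 t -> (0 <= f t)%E.
  by rewrite /I01 /= in_itv /= => /andP[t0 _]; rewrite lee_fin divr_ge0 ?powR_ge0 // ltW.
have I1 : (\int[mu]_(t in I01) f t < +oo)%E.
  have : (alpha%:E * \int[mu]_(t in I01) f t <= 1)%E.
    rewrite -ge0_integralZl_EFin //; last exact: ltW.
    apply: le_trans powR_integral_le1; rewrite le_eqVlt; apply/orP; left; apply/eqP.
    by apply: eq_integral => t /set_mem; rewrite /I01 /= in_itv /= => /andP[t0 _]; exact: fE.
  case: (\int[mu]_(t in _) f t)%E => [r _|| _] //; rewrite ?ltry ?ltNyr //.
  by rewrite mulry gtr0_sg // mul1e.
have k0 : 0 <= @disk_area R by exact: ltW (disk_area_gt0).
have dI : disk 1 = depth @^-1` I01 :> set AT.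
  apply/seteqP; split => p; rewrite /disk /depth /I01 /= in_itv /=.
    by move=> h; rewrite subr_gt0 h gerBl sqnorm_ge0.
  by move=> /andP[]; rewrite subr_gt0.
have EM X : measurable X -> X `<=` I01 ->
    image_measure (@area R) measurable_fun_depth_area X = mscale (NngNum k0) mu X.
  move=> mX XI; have mX' : measurable (depth @^-1` X : set (RT * RT)).
    exact: (measurable_preimage measurable_depth mX).
  have X1 : X `<=` `]-oo, 1].
    by move=> t /XI; rewrite /I01 /= !in_itv /= => /andP[].
  exact: etrans (area_borel mX') (image_depth mX X1).
have f0' : {in I01, forall t, (0 <= f t)%E} by move=> t /set_mem; exact: f0.
have E : (\int[@area R]_(p in disk 1) (power_weight alpha (depth p) / depth p)%:E =
   (@disk_area R)%:E * \int[mu]_(t in I01) f t)%E.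
  rewrite -(ge0_integral_mscale mu mI (NngNum k0) mf f0) dI.
  apply: etrans (esym (ge0_integral_pushforward measurable_fun_depth_area (@area R) mI mf f0')) _.
  exact: (@eq_measure_integral _ RT R I01 (mscale (NngNum k0) mu)
    (image_measure (@area R) measurable_fun_depth_area) f EM).
by rewrite E lte_mul_pinfty // lee_fin.
Qed.

End PowerWeight.

(** * Weighted norms *)

Lemma mule_finI (R : realType) (k : R) (x y : \bar R) :
  0 < k -> (k%:E * x = k%:E * y -> x = y)%E.
Proof.
move=> k0 H; have k0' : (0 < k%:E)%E by rewrite lte_fin.
by apply/eqP; rewrite eq_le; apply/andP; split; rewrite -(lee_pmul2l _ k0') // H.
Qed.

Section WeightedNorm.
Context {R : realType}.
Notation AT := (@area_type R).

Lemma weighted_normE (g : R -> R) N (a : 'I_N -> R[i]) :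
  weighted_norm g (cauchy_sum a) =
  (((weight_const g)%:E *
    \int[@area R]_(p in disk 1) (cauchy_density a p * g (depth p))%:E) `^ 2^-1)%E.
Proof.
rewrite /weighted_norm unit_disk_disk; congr (((_ * _) `^ _)%E).
by apply: eq_integral => p _; rewrite sqr_normc_cplx.
Qed.

Lemma depth_range p : disk 1 p -> 0 <= (@depth R p) <= 1.
Proof. by move=> p1; rewrite subr_ge0 (ltW p1) gerBl sqnorm_ge0. Qed.

Lemma depth_rotc c p : normc c = 1 -> depth (rotc c p) = @depth R p.
Proof. by move=> c1; rewrite /depth sqnorm_rotc. Qed.

Section weight.
Variable g : R -> R.
Hypothesis g0 : forall t, 0 <= t <= 1 -> 0 <= g t.
Hypothesis mg : measurable_fun (disk 1 : set AT) (fun p => g (depth p)).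

Lemma weight_const_ge0 : 0 <= weight_const g.
Proof.
rewrite invr_ge0; apply: Rintegral_ge0 => t /=; rewrite in_itv /=; exact: g0.
Qed.

Let W0 p : disk 1 p -> 0 <= g (depth p).
Proof. by move=> /depth_range; exact: g0. Qed.

Let W_rot c p : normc c = 1 -> g (depth (rotc c p)) = g (depth p).
Proof. by move=> c1; rewrite depth_rotc. Qed.

Variables (N : nat) (a : 'I_N -> R[i]).
Hypothesis N0 : (0 < N)%N.
Hypothesis a1 : forall k, normc (a k) = 1.

Lemma weighted_norm_base_ge0 (b : 'I_N -> R[i]) :
  (0 <= (weight_const g)%:E *
    \int[@area R]_(p in disk 1) (cauchy_density b p * g (depth p))%:E)%E.
Proof.
apply: mule_ge0; first by rewrite lee_fin weight_const_ge0.
by apply: integral_ge0 => p p1; exact: (cauchyW_ge0 W0).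
Qed.

Lemma weighted_norm_min :
  (weighted_norm g (cauchy_sum (@equispaced R N)) <= weighted_norm g (cauchy_sum a))%E.
Proof.
rewrite !weighted_normE; apply: gt0_ler_poweR; first by rewrite invr_ge0.
- by rewrite in_itv /= weighted_norm_base_ge0 leey.
- by rewrite in_itv /= weighted_norm_base_ge0 leey.
apply: lee_wpmul2l; first by rewrite lee_fin weight_const_ge0.
exact: (weighted_integral_min mg W0 W_rot N0 a1).
Qed.

Hypothesis K0 : 0 < weight_const g.
Hypothesis g_gt0 : forall t, 0 < t <= 1 -> 0 < g t.
Hypothesis g_fin : (\int[@area R]_(p in disk 1) (g (depth p) / depth p)%:E < +oo)%E.

Lemma weighted_norm_min_eq :
  weighted_norm g (cauchy_sum a) = weighted_norm g (cauchy_sum (@equispaced R N)) ->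
  exists c : R[i], normc c = 1 /\
    exists s : 'S_N, forall k, a k = c * @equispaced R N (s k).
Proof.
move=> E; apply: (weighted_integral_min_eq mg W0 W_rot N0 _ g_fin a1).
  move=> p p1; apply: g_gt0; have /andP[_ ->] := depth_range p1.
  by rewrite andbT subr_gt0.
(* Squaring removes the root from both norms; the positive finite constant then cancels, even
   against infinite values. *)
have sq (x : \bar R) : (0 <= x)%E -> ((x `^ 2^-1) `^ 2 = x)%E.
  by move=> x0; rewrite -poweRrM mulVf ?pnatr_eq0 // poweRe1.
have := congr1 (fun x => x `^ 2)%E E; rewrite !weighted_normE !sq ?weighted_norm_base_ge0 //.
exact: mule_finI K0.
Qed.

End weight.

Lemma power_weight_depth_measurable (alpha : R) :
  measurable_fun (disk 1 : set AT) (fun p => power_weight alpha (depth p)).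
Proof.
apply: measurable_fun_area; first exact: measurable_disk.
apply: measurable_funTS.
exact: measurableT_comp (measurable_powR alpha) measurable_depth.
Qed.

(** An integral equal to 0 or to +oo would make [weight_const] 0 by convention, so both must be
    excluded: from below by the values on [1/2, 1], where the weight is at least (1/2)^alpha, from
    above by the constant 1. *)
Lemma power_weight_const_gt0 (alpha : R) : 0 < alpha -> 0 < weight_const (power_weight alpha).
Proof.
move=> alpha0; rewrite invr_gt0; apply: fine_gt0.
pose LT : measurableType _ := caratheodory_type ((@wlength R idfun)^*)%mu.
have mI (i : interval R) : measurable ([set` i] : set LT).
  by apply: sub_caratheodory; exact: measurable_itv.
have mp : measurable_fun [set: LT] (EFin \o power_weight alpha : LT -> \bar R).
  apply/measurable_EFinP => _ Y mY; apply: sub_caratheodory.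
  by apply: (measurable_powR alpha).
have p0 t : (0 <= (EFin \o power_weight alpha) t)%E by rewrite lee_fin powR_ge0.
have lI (i : interval R) : @completed_lebesgue_measure R [set` i] = @lebesgue_measure R [set` i].
  by [].
pose h : R := 2^-1; pose k : R := h `^ alpha.
have h0 : 0 < h by rewrite invr_gt0.
have h1 : h < 1 by rewrite invf_lt1 // ltr1n.
apply/andP; split.
  apply: (@lt_le_trans _ _ (k%:E * @completed_lebesgue_measure R `[h, 1%R])%E).
    rewrite lI lebesgue_measure_itv /= lte_fin h1 -EFinB -EFinM lte_fin.
    by rewrite mulr_gt0 ?powR_gt0 // subr_gt0.
  rewrite -(integral_cst (@completed_lebesgue_measure R) (mI `[h, 1%R])).
  apply: (@le_trans _ _ (\int[@completed_lebesgue_measure R]_(t in `[h, 1%R]) (power_weight alpha t)%:E)%E).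
    refine (@ge0_le_integral _ _ _ (@completed_lebesgue_measure R) _ (mI _) _ _ _
      (measurable_cst _) (measurable_funTS mp) _) => [t _|t].
      by rewrite lee_fin powR_ge0.
    rewrite /= in_itv /= => /andP[t2 _]; rewrite lee_fin.
    by rewrite ge0_ler_powR ?nnegrE ?(ltW alpha0) ?(ltW h0) // (le_trans _ t2) // ltW.
  refine (@ge0_subset_integral _ _ _ (@completed_lebesgue_measure R) _ _
    (mI _) (mI _) _ (measurable_funTS mp) _ _) => [t _|t].
    exact: p0.
  by rewrite /= !in_itv /= => /andP[t2 ->]; rewrite andbT (le_trans _ t2) // ltW.
apply: (@le_lt_trans _ _ (1 * @completed_lebesgue_measure R `[0%R, 1%R])%E); last first.
  by rewrite lI lebesgue_measure_itv /= lte_fin ltr01 mul1e ltry.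
rewrite -(integral_cst (@completed_lebesgue_measure R) (mI `[0%R, 1%R])).
refine (@ge0_le_integral _ _ _ (@completed_lebesgue_measure R) _ (mI _) _ _ _
      (measurable_funTS mp) (measurable_cst _) _) => [t _|t].
  exact: p0.
rewrite /= in_itv /= => /andP[t0 t1]; rewrite lee_fin.
have := @ge0_ler_powR R alpha (ltW alpha0) t 1; rewrite !nnegrE t0 ler01 powR1.
by move=> /(_ isT isT t1).
Qed.

Lemma weight_depth_measurable (g : R -> R) :
  (@completed_lebesgue_measure R).-integrable `[0, 1] (EFin \o g) ->
  measurable_fun (disk 1 : set AT) (fun p => g (depth p)).
Proof.
move=> /integrableP[/measurable_EFinP mg _].
apply: measurable_fun_depth => Y mY; apply: mg => //.
by apply: sub_caratheodory; exact: measurable_itv.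
Qed.

End WeightedNorm.

Theorem theorem8 (R : realType) :
  (forall g : R -> R,
      (forall t : R, 0 <= t <= 1 -> 0 <= g t) ->
      (@completed_lebesgue_measure R).-integrable `[0, 1] (EFin \o g) ->
      ~ {ae @completed_lebesgue_measure R,
           forall t : R, 0 <= t <= 1 -> g t = 0} ->
      (\int[@completed_lebesgue_measure R]_(s in `[0%R, 1%R]) (g s / s)%:E
         < +oo)%E ->
      forall (N : nat) (a : 'I_N -> R[i]),
        (1 <= N)%N ->
        (forall k, normc (a k) = 1) ->
        (weighted_norm g (cauchy_sum (@equispaced R N))
           <= weighted_norm g (cauchy_sum a))%E)
  /\
  (forall alpha : R, 0 < alpha ->
      forall (N : nat) (a : 'I_N -> R[i]),
        (1 <= N)%N ->
        (forall k, normc (a k) = 1) ->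
        (weighted_norm (power_weight alpha)
             (cauchy_sum (@equispaced R N))
           <= weighted_norm (power_weight alpha) (cauchy_sum a))%E
        /\
        (weighted_norm (power_weight alpha) (cauchy_sum a)
           = weighted_norm (power_weight alpha)
               (cauchy_sum (@equispaced R N)) ->
         exists c : R[i], normc c = 1 /\
           exists s : 'S_N, forall k, a k = c * @equispaced R N (s k))).
Proof.
split=> [g g0 ig _ _ N a N0 a1|alpha alpha0 N a N0 a1].
  exact: (weighted_norm_min g0 (weight_depth_measurable ig) N0 a1).
have p0 t : 0 <= t <= 1 -> 0 <= power_weight alpha t by move=> _; exact: powR_ge0.
have mp := power_weight_depth_measurable alpha.
split; first exact: weighted_norm_min.
apply: weighted_norm_min_eq => //.
- exact: power_weight_const_gt0.
- by move=> t /andP[t0 _]; exact: powR_gt0.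
- exact: power_weight_fin.
Qed.
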